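(* Assume that the probability space $\Omega_1$ is complete and that $\mathbb{P}_1=\times_{n\in I}p_n$ is such that every $p_n$, $n\in I$, is a continuous measure. Fix sequences $R=\{r_n\}_{n\in I}\subset(0,\infty)$ and $\Theta=\{\theta_n\}_{n\in I}\subset\mathbb{R}$. Let $E\in\mathbb{R}$ be fixed, let $P_{R,\Theta}(E):=\{\Lambda\in\Omega_1: E\in\sigma_p(H_{\Lambda,R,\Theta})\}$, and let $B$ be any measurable subset of $P_{R,\Theta}(E)$. Then one of the following holds: (i) $\mathbb{P}_1(B)=0$; (ii) $P_{R,\Theta}(E)=\Omega_1$.
   Context: Let $-\infty\le a<b\le\infty$, $V\in L^1_{\mathrm{loc}}(a,b)$ real-valued, $\tau f:=-f''+Vf$, and let $M=\{x_n\}_{n\in I}\subset(a,b)$, $I\subseteq\mathbb{Z}$, be a fixed discrete set of (distinct) points accumulating at most at $a$ or $b$. For $\Lambda=\{\alpha_n\}_{n\in I}\in\mathbb{R}^I$, $R=\{r_n\}_{n\in I}\in(0,\infty)^I$, $\Theta=\{\theta_n\}_{n\in I}\in\mathbb{R}^I$, set $$A_{\alpha_n,r_n,\theta_n}:=\begin{pmatrix}1&\alpha_n\\0&1\end{pmatrix}\begin{pmatrix}r_n&0\\0&1/r_n\end{pmatrix}\begin{pmatrix}\cos\theta_n&-\sin\theta_n\\ \sin\theta_n&\cos\theta_n\end{pmatrix}.$$ Interface conditions: $(f(x_n+),f'(x_n+))^T=A_{\alpha_n,r_n,\theta_n}(f(x_n-),f'(x_n-))^T$ for all $n\in I$. For $z\in\mathbb{C}$,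 a solution of $(\tau_{\Lambda,R,\Theta}-z)f=0$ is a function $f$ with $f,f'$ (locally) absolutely continuous in $(a,b)\setminus M$, $-f''+Vf-zf=0$, satisfying the interface conditions. $\tau_{\Lambda,R,\Theta}$ is in the limit point case at $a$ (resp. $b$) if for every $z\in\mathbb{C}$ at least one solution of $(\tau_{\Lambda,R,\Theta}-z)f=0$ is not square integrable near $a$ (resp. $b$). It is regular at $a$ if $a$ is finite, $V\in L^1_{\mathrm{loc}}[a,b)$ and $a$ is not an accumulation point of $M$; analogously at $b$. Standing assumption: at $a$, either $\tau_{\Lambda,R,\Theta}$ is regular or it is in the limit point case (for all parameter sequences considered), and likewise at $b$. The selfadjoint operator $H_{\Lambda,R,\Theta}$ in $L^2(a,b)$ acts as $H_{\Lambda,R,\Theta}f=\tau f$ on the domain of all $f\in L^2(a,b)$ such that $f,f'$ are (locally) absolutely continuous in $(a,b)\setminus M$, $-f''+Vf\in L^2(a,b)$, the interface conditions hold, and, at each regular endpoint, a fixed boundary condition holds: $f(a)\cos\psi_a+f'(a)\sin\psi_a=0$ if regular at $a$, and $f(b)\cos\psi_b+f'(b)\sin\psi_b=0$ if regular at $b$, with fixed $\psi_a,\psi_b\in[0,\pi)$ (no condition at a limit point endpoint). $\sigma_p$ denotes the set of eigenvalues. Probability space: $\{p_n\}_{n\in I}$ are probability measures on $\mathbb{R}$ (Borel), and $\Omega_1=(\mathbb{R}^I,\mathcal{F}_1,\mathbb{P}_1)$ with $\mathbb{P}_1=\times_{n\in I}p_n$ the product measure on the product $\sigma$-algebra $\mathcal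 F_1$ generated by cylinder sets. ''$\Omega_1$ complete'' means subsets of sets of measure zero are measurable (the $\sigma$-algebra is replaced by its completion). A measure is continuous if it gives measure zero to every single point. *)

(* Defs.v *)
From HB Require Import structures.
From mathcomp Require Import all_boot all_order all_algebra.
From mathcomp Require Import all_classical all_reals all_analysis.
From mathcomp Require Import measurable_realfun.
From mathcomp.real_closed Require Import complex.

Set Implicit Arguments.
Unset Strict Implicit.
Unset Printing Implicit Defensive.

Import Order.TTheory GRing.Theory Num.Theory.
Import numFieldNormedType.Exports.
Import Normc.

Local Open Scope classical_set_scope.
Local Open Scope ring_scope.
Local Open Scope complex_scope.

Section completion.
Local Open Scope ereal_scope.
Context d (T : measurableType d) (R : realType).
Variable mu : {measure set T -> \bar R}.

(* [completed_algebra_gen mu] is the family of all A `|` N with A measurable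
   and N negligible; it is already a sigma-algebra (lemma [completed_typeE]). *)
Local Notation completed_type :=
  (g_sigma_algebraType (completed_algebra_gen mu)).

Lemma completed_typeE :
  (measurable : set (set completed_type)) = completed_algebra_gen mu.
Proof.
apply/seteqP; split; last first.
  move=> _ [/= A /= mA [N neglN]] <-.
  by apply: sub_sigma_algebra; exists A => //; exists N.
apply: smallest_sub => //=; split => /=.
- by exists set0 => //; exists set0; [exact: negligible_set0|rewrite setU0].
- move=> G [/= A mA [N negN ANG]]; case: negN => /= F [mF F0 NF].
  have GANA : ~` G = ~` A `\` (N `&` ~` A).
    by rewrite -ANG setCU setDE setCI setCK setIUr setICl setU0.
  pose AA := ~` A `\` (F `&` ~` A).
  pose NN := (F `&` ~` A) `\` (N `&` ~` A).
  have GAANN : ~` G = AA `|` NN.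
    rewrite (_ : ~` G = ~` A `\` (N `&` ~` A))//.
    by apply: setDU; [exact: setSI|exact: subIsetr].
  exists AA.
    apply: measurableI => //=; first exact: measurableC.
    by apply: measurableC; apply: measurableI => //; exact: measurableC.
  by exists NN; [exists F; split => // x [] []|rewrite setDE setTI].
- move=> F mF/=.
  pose A n := projT1 (cid2 (mF n)).
  pose N n := projT1 (cid2 (projT2 (cid2 (mF n))).2).
  exists (\bigcup_k A k).
    by apply: bigcupT_measurable => i; rewrite /A; case: cid2.
  exists (\bigcup_k N k).
    apply: negligible_bigcup => /= k.
    by rewrite /N; case: (cid2 (mF k)) => //= *; case: cid2.
  rewrite -bigcupU; apply: eq_bigcup => // i _.
  by rewrite /A /N; case: (cid2 (mF i)) => //= *; case: cid2.
Qed.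

(* The value of the completed measure is the outer measure induced by mu; it
   agrees with mu on measurable sets (lemma [completed_measureE]). *)
Definition completed_measure : set completed_type -> \bar R := (mu^*)%mu.

Lemma completed_measureE (A : set T) :
  measurable A -> completed_measure A = mu A.
Proof. by move=> mA; rewrite /completed_measure measurable_mu_extE. Qed.

Lemma measurable_completed_caratheodory (A : set completed_type) :
  measurable A -> (mu^*)%mu.-cara.-measurable A.
Proof.
rewrite completed_typeE => -[X mX] [N [F [mF F0 NF]] <-].
apply: measurableU; first exact: caratheodory_measurable_mu_ext.
apply: (@measure_is_complete_caratheodory _ _ (mu^*)%mu).
exists F; split => //; first exact: caratheodory_measurable_mu_ext.
by rewrite -F0; exact: measurable_mu_extE.
Qed.

Let completed_measure0 : completed_measure set0 = 0.
Proof. exact: mu_ext0. Qed.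

Let completed_measure_ge0 (A : set completed_type) : 0 <= completed_measure A.
Proof. exact: mu_ext_ge0. Qed.

Let completed_measure_sigma_additive : semi_sigma_additive completed_measure.
Proof.
move=> F mF tF mUF; rewrite /completed_measure.
apply: caratheodory_measure_sigma_additive => //.
- by move=> i; exact: measurable_completed_caratheodory.
- exact: measurable_completed_caratheodory.
Qed.

HB.instance Definition _ := isMeasure.Build _ _ _ completed_measure
  completed_measure0 completed_measure_ge0 completed_measure_sigma_additive.

Lemma completed_measure_is_complete : measure_is_complete completed_measure.
Proof.
move=> N [B [mB B0 NB]]; rewrite completed_typeE.
move: mB B0 NB; rewrite completed_typeE.
move=> -[X mX] [M [F [mF F0 MF]] <-] B0 NB.
exists set0 => //; exists N; last by rewrite set0U.
apply: (@negligibleS _ _ _ mu (X `|` F)).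
  by apply: subset_trans NB _; exact: setUS.
apply: negligibleU; last by exists F; split.
exists X; split => //; apply: (eq_trans (esym (completed_measureE mX))).
apply/eqP; rewrite eq_le outer_measure_ge0 andbT -B0.
by apply: le_outer_measure; exact: subsetUl.
Qed.

End completion.

Notation completed_type mu := (g_sigma_algebraType (completed_algebra_gen mu)).
Arguments completed_measure {d T R} mu A.

Section product_space.
Context (R : realType) (I : set int).

(* U is only constrained at the finitely many indices listed in J. *)
Definition cylinder (J : seq I) (U : I -> set R) : set (I -> R) :=
  [set L | forall n, n \in J -> U n (L n)].

Definition cylinders : set (set (I -> R)) :=
  [set A | exists J U, (forall n, measurable (U n)) /\ A = cylinder J U].

Definition is_product_measure (p : I -> probability R R)
    (P : probability (g_sigma_algebraType cylinders) R) :=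
  forall (J : seq I) (U : I -> set R), uniq J -> (forall n, measurable (U n)) ->
    P (cylinder J U) = (\prod_(n <- J) p n (U n))%E.

End product_space.

Notation Omega1 R I := (g_sigma_algebraType (@cylinders R I)).

(* Calculus for functions R -> R[i].  The library puts no normed-module
   structure over R on R[i], so derivatives are taken on real and imaginary
   parts and limits are expressed through the modulus [normc]. *)
Section complex_valued_functions.
Context {R : realType}.
Implicit Types (f : R -> R[i]) (D : set R) (t : R) (l : R[i]).
Local Notation mu := (@lebesgue_measure R).

Definition cderivable f t :=
  derivable (@complex.Re R \o f) t 1 /\ derivable (@complex.Im R \o f) t 1.

Definition cderive f t : R[i] :=
  derive1 (@complex.Re R \o f) t +i* derive1 (@complex.Im R \o f) t.

Definition left_limit f t l := normc (f s - l) @[s --> t^'-] --> (0 : R).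

Definition right_limit f t l := normc (f s - l) @[s --> t^'+] --> (0 : R).

Definition absolutely_continuous (c d : R) f :=
  forall e : R, 0 < e -> exists2 delta : R, 0 < delta &
    forall (n : nat) (u v : 'I_n -> R),
      (forall i, c <= u i <= v i /\ v i <= d) ->
      (forall i j, i != j -> `]u i, v i[ `&` `]u j, v j[ = set0) ->
      \sum_(i < n) (v i - u i) < delta ->
      \sum_(i < n) normc (f (v i) - f (u i)) < e.

Definition locally_absolutely_continuous D f :=
  forall c d : R, c <= d -> `[c, d] `<=` D -> absolutely_continuous c d f.

Definition square_integrable D f :=
  [/\ measurable_fun D (@complex.Re R \o f), measurable_fun D (@complex.Im R \o f) &
      (\int[mu]_(t in D) ((normc (f t)) ^+ 2)%:E < +oo)%E].

End complex_valued_functions.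

Section schroedinger.
Context {R : realType}.
Variables (a b : \bar R) (V : R -> R) (I : set int) (x : I -> R).
Implicit Types (f : R -> R[i]) (z : R[i]) (alpha r theta : I -> R) (n : I).
Local Notation mu := (@lebesgue_measure R).

Definition oab : set R := [set t | (a < t%:E < b)%E].

Definition points : set R := range x.

Definition interaction_points :=
  [/\ injective x, points `<=` oab &
      forall t, oab t -> ~ limit_point points t].

Definition interface_matrix (alpha_n r_n theta_n : R) : 'M[R]_2 :=
  (block_mx 1%:M alpha_n%:M 0 1%:M : 'M[R]_(1 + 1)) *m
  (block_mx r_n%:M 0 0 (r_n^-1)%:M : 'M[R]_(1 + 1)) *m
  (block_mx (cos theta_n)%:M (- sin theta_n)%:M
            (sin theta_n)%:M (cos theta_n)%:M : 'M[R]_(1 + 1)).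

Definition cvec2 (u v : R[i]) : 'cV[R[i]]_2 :=
  (col_mx u%:M v%:M : 'cV[R[i]]_(1 + 1)).

Definition interface_condition alpha r theta f n :=
  exists um dum up dup : R[i],
    [/\ left_limit f (x n) um, left_limit (cderive f) (x n) dum,
        right_limit f (x n) up, right_limit (cderive f) (x n) dup &
        cvec2 up dup =
        map_mx (real_complex R)
          (interface_matrix (alpha n) (r n) (theta n)) *m cvec2 um dum].

(* f and f' are locally absolutely continuous in (a, b) \ points. The almost
   everywhere differentiability of f' is a consequence (Lebesgue); it is
   recorded because f'' is the total function [cderive (cderive f)]. *)
Definition ac_with_derivative f :=
  [/\ forall t, (oab `\` points) t -> cderivable f t,
      locally_absolutely_continuous (oab `\` points) f,
      locally_absolutely_continuous (oab `\` points) (cderive f) &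
      {ae mu, forall t, (oab `\` points) t -> cderivable (cderive f) t}].

Definition tau f (t : R) : R[i] := - cderive (cderive f) t + (V t)%:C * f t.

Definition is_solution alpha r theta z f :=
  [/\ ac_with_derivative f,
      {ae mu, forall t, oab t -> tau f t - z * f t = 0} &
      forall n, interface_condition alpha r theta f n].

Definition square_integrable_near_left f :=
  exists2 c, oab c & square_integrable [set t | oab t /\ t < c] f.

Definition square_integrable_near_right f :=
  exists2 c, oab c & square_integrable [set t | oab t /\ c < t] f.

Definition limit_point_left alpha r theta :=
  forall z, exists2 f, is_solution alpha r theta z f &
    ~ square_integrable_near_left f.

Definition limit_point_right alpha r theta :=
  forall z, exists2 f, is_solution alpha r theta z f &
    ~ square_integrable_near_right f.

Definition regular_left_at (a0 : R) :=
  [/\ a = a0%:E,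
      forall c, oab c -> mu.-integrable `[a0, c] (EFin \o V) &
      ~ limit_point points a0].

Definition regular_right_at (b0 : R) :=
  [/\ b = b0%:E,
      forall c, oab c -> mu.-integrable `[c, b0] (EFin \o V) &
      ~ limit_point points b0].

Definition regular_or_limit_point alpha r theta :=
  ((exists a0, regular_left_at a0) \/ limit_point_left alpha r theta) /\
  ((exists b0, regular_right_at b0) \/ limit_point_right alpha r theta).

(* psia, psib are used only at regular endpoints. *)
Variables (psia psib : R).

Definition boundary_condition_left f :=
  forall a0, regular_left_at a0 -> exists u du : R[i],
    [/\ right_limit f a0 u, right_limit (cderive f) a0 du &
        u * (cos psia)%:C + du * (sin psia)%:C = 0].

Definition boundary_condition_right f :=
  forall b0, regular_right_at b0 -> exists u du : R[i],
    [/\ left_limit f b0 u, left_limit (cderive f) b0 du &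
        u * (cos psib)%:C + du * (sin psib)%:C = 0].

(* Domain of H; H acts on it as [tau].  Elements of L^2(a, b) are functions
   R -> R[i] considered up to equality almost everywhere on (a, b). *)
Definition H_domain alpha r theta f :=
  [/\ square_integrable oab f, ac_with_derivative f,
      square_integrable oab (tau f),
      forall n, interface_condition alpha r theta f n &
      boundary_condition_left f /\ boundary_condition_right f].

Definition H_point_spectrum alpha r theta : set R[i] :=
  [set z | exists f, [/\ H_domain alpha r theta f,
      ~ {ae mu, forall t, oab t -> f t = 0} &
      {ae mu, forall t, oab t -> tau f t = z * f t}]].

Definition eigenvalue_set r theta (E : R) : set (Omega1 R I) :=
  [set alpha | H_point_spectrum alpha r theta E%:C].

End schroedinger.

(* Main.v *)
Require Import Defs.
From mathcomp Require Import all_boot all_order all_algebra.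
From mathcomp Require Import all_classical all_reals all_analysis.
From mathcomp Require Import measurable_realfun.
From mathcomp.real_closed Require Import complex.
From mathcomp Require Import ring lra.

Import Order.TTheory GRing.Theory Num.Theory.
Import numFieldNormedType.Exports.

Local Open Scope classical_set_scope.
Local Open Scope ring_scope.

Set Implicit Arguments.
Unset Strict Implicit.
Unset Printing Implicit Defensive.

(** The eigenvalue [E] is unstable under a change of a single parameter
    [alpha n].  Since [E] is real, real and imaginary parts of eigenfunctions are
    real solutions of [- u'' + V u = E u] and everything can be done with the
    Wronskian [W(u, v) = u v' - u' v] of real functions.

    Let [u] and [v] be eigenfunctions for two parameter sequences that differ
    only at [n].  The Wronskian is constant on every interval free of interaction
    points ([abs_cont_ae_nondecreasing]: an absolutely continuous function
    with a.e. nonnegative derivative is nondecreasing), and the interface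
    matrices, having determinant 1, carry it over every [x k] at which the two
    sequences agree ([wronskian_germ]).  So [W(u, v)] is constant on each side of
    [x n].  It is zero there: at a regular endpoint by the boundary condition;
    at a limit point endpoint because the identity
    [h W(u, v) = u W(h, v) - v W(h, u)] would otherwise make every solution [h]
    square integrable ([wronskian_left], [wronskian_right]).  Comparing both
    sides at [x n] gives [(alpha n - alpha' n) u'(x n +) v'(x n +) = 0], and since
    [v] is not identically zero it has nonzero data at [x n], by a Gronwall
    argument for [v^2 + v'^2] ([solution_unique]).  Hence [u'(x n +) = 0]
    ([derivative_vanishes]), and then the interface condition at [x n] holds for
    [u] whatever the value of [alpha n].  Therefore, if for every [n] the number
    [E] remains an eigenvalue for some other choice of [alpha n] alone, it is an
    eigenvalue for all sequences ([eigenvalue_of_all_parameters]).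

    Such a sequence exists in every measurable set [X] of eigenvalue parameters
    of positive probability.  Resampling the coordinate [n] independently with
    law [p n] preserves the product measure ([resample_invariant]), so by Fubini
    almost every point of [X] has, for each of the countably many [n], a section
    of [X] of positive [p n]-measure in the direction [n]; as [p n] has no atoms,
    that section has a point different from the given one
    ([exists_flexible]). *)

(** * Absolutely continuous functions with nonnegative derivative *)

(** Induction along a segment: a property that holds at [c] and passes, near
    each [m], from points on the left of [m] to points on its right, holds at
    [d].  It plays the role of compactness. *)
Lemma interval_induction (R : realType) (P : R -> Prop) (c d : R) :
  c <= d -> P c ->
  (forall m, c <= m <= d -> exists2 h, 0 < h & forall u v,
     c <= u -> u <= m -> m <= v -> v <= d -> m - h < u -> v < m + h ->
     P u -> P v) ->
  P d.
Proof.
move=> cd Pc step; pose S := [set t | c <= t <= d /\ P t].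
have Sc : S c by rewrite /S/= lexx cd.
have Sub t : S t -> t <= d by case=> /andP[].
have supS : has_sup S by split; [exists c | exists d => t /Sub].
have cm : c <= sup S by apply: ub_le_sup => //; exists d => t /Sub.
have md : sup S <= d by apply: ge_sup; [exists c | move=> t /Sub].
have [|h h0 hstep] := step (sup S); first by rewrite cm.
have [u [/andP[cu ud] Pu] mu] := sup_adherent h0 supS.
have um : u <= sup S by apply: ub_le_sup; [exists d => t /Sub | rewrite /S/= cu].
have [mltd|/(conj md)/andP/le_anti mEd] := ltP (sup S) d; last first.
  by rewrite mEd in hstep mu um; apply: (hstep u d) => //; rewrite ltrDl.
pose v := Num.min d (sup S + h / 2).
have mv : sup S < v by rewrite lt_min mltd /= ltrDl divr_gt0.
have Sv : S v.
  split; first by rewrite (le_trans cm (ltW mv)) /= ge_min lexx.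
  apply: (hstep u v) => //; first exact: ltW.
    by rewrite ge_min lexx.
  by rewrite gt_min ltrD2l ltr_pdivrMr// mulr2n mulrDr mulr1 ltrDl h0 orbT.
have : v <= sup S by apply: ub_le_sup => //; exists d => t /Sub.
by rewrite leNgt mv.
Qed.

(** Absolute continuity of a real function on [[c, d]].  As for complex-valued
    functions, the disjoint intervals are indexed by ['I_n] and may be
    degenerate. *)
Definition abs_cont {R : realType} (c d : R) (F : R -> R) :=
  forall e : R, 0 < e -> exists2 delta : R, 0 < delta &
    forall (n : nat) (u v : 'I_n -> R),
      (forall i, c <= u i <= v i /\ v i <= d) ->
      (forall i j, i != j -> `]u i, v i[ `&` `]u j, v j[ = set0) ->
      \sum_(i < n) (v i - u i) < delta ->
      \sum_(i < n) `|F (v i) - F (u i)| < e.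

(** The increment is taken between two points on either side of [m], as needed
    for a segment tagged by [m]. *)
Lemma derive_ge0_straddle (R : realType) (F : R -> R) (m e : R) :
  derivable F m 1 -> 0 <= derive1 F m -> 0 < e ->
  exists2 h, 0 < h & forall u v, m - h < u -> u <= m -> m <= v -> v < m + h ->
    F u - F v <= e * (v - u).
Proof.
move=> dF F0 e0.
have : h^-1 *: (F (h *: 1 + m) - F m) @[h --> 0^'] --> derive1 F m.
  by rewrite derive1E; exact: dF.
move=> /cvgrPdist_lt /(_ e e0); rewrite near_withinE => -[h /= h0 H].
have H' s : s != 0 -> `|s| < h -> - e < s^-1 * (F (s + m) - F m).
  move=> s0 sh; have := H s; rewrite /= sub0r normrN => /(_ sh s0).
  rewrite /GRing.scale/= mulr1 ltr_norml => /andP[_].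
  by rewrite ltrBlDr -ltrBlDl; apply: le_lt_trans; rewrite lerBrDr addNr.
exists h => // u v hu um mv vh.
have H1 : F m - F v <= e * (v - m).
  have [<-|mv'] := eqVneq m v; first by rewrite !subrr mulr0.
  have vm : 0 < v - m by rewrite subr_gt0 lt_neqAle mv'.
  have /H' : v - m != 0 by rewrite gt_eqF.
  rewrite gtr0_norm// subrK ltrBlDl => /(_ vh).
  by rewrite ltr_pdivlMl// => /ltW ?; lra.
have H2 : F u - F m <= e * (m - u).
  have [->|um'] := eqVneq u m; first by rewrite !subrr mulr0.
  have vm : u - m < 0 by rewrite subr_lt0 lt_neqAle um'.
  have /H' : u - m != 0 by rewrite lt_eqF.
  rewrite ltr0_norm// subrK opprB ltrBlDl -ltrBlDr => /(_ hu).
  by rewrite ltr_ndivlMl// => /ltW ?; lra.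
lra.
Qed.

(** The exceptional null set is covered by an open set [U] of small measure.
    A segment around a point of [U] can be taken inside [U], a segment around
    another point obeys [derive_ge0_straddle], and [interval_induction] glues
    the segments; absolute continuity bounds the contribution of [U]. *)
Lemma abs_cont_ae_nondecreasing (R : realType) (c d : R) (F : R -> R) :
  c <= d -> abs_cont c d F ->
  {ae @lebesgue_measure R, forall t, c < t < d ->
     derivable F t 1 /\ 0 <= derive1 F t} ->
  F c <= F d.
Proof.
move=> cd acF [A [mA A0 NA]]; rewrite -subr_le0; apply/ler_addgt0Pl => e e0.
rewrite addr0.
pose e' := e / (2 * (d - c + 1)).
have dc1 : 0 < d - c + 1 by rewrite ltr_wpDl// subr_ge0.
have e'0 : 0 < e' by rewrite divr_gt0// mulr_gt0.
have [delta delta0 Hdelta] := acF (e / 2) ltac:(by rewrite divr_gt0).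
have mcd : measurable [set c; d] by apply: measurableU; exact: measurable_set1.
have muN : lebesgue_measure (A `|` [set c; d]) = 0%E.
  rewrite measureU0 ?A0//; apply: countable_lebesgue_measure0.
  by apply/finite_set_countable/finite_set2.
have mN : measurable (A `|` [set c; d]) by exact: measurableU.
have [|U [oU NU Udelta']] := lebesgue_regularity_outer mN _ delta0.
  by move: muN => /= ->.
have Udelta : (lebesgue_measure U < delta%:E)%E.
  apply: le_lt_trans Udelta'; have mU : measurable U by exact: open_measurable.
  have {1}-> : U = (U `\` (A `|` [set c; d])) `|` (A `|` [set c; d]).
    by rewrite setUC setUDr setDv setD0 setUC; apply/esym/setUidPl.
  rewrite (le_trans (measureU2 _ _ _))//; first exact: measurableD.
  by rewrite -[leRHS]adde0 leeD2l//; move: muN => /eqP; rewrite eq_le => /andP[].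
(* the increment up to t is controlled except on finitely many segments in U *)
pose P t := exists n (u v : 'I_n -> R),
  [/\ forall i, c <= u i <= v i /\ v i <= t,
      forall i j, i != j -> `]u i, v i[ `&` `]u j, v j[ = set0,
      forall i, `]u i, v i[ `<=` U &
      F c - F t <= e' * (t - c) + \sum_(i < n) `|F (v i) - F (u i)|].
have : P d.
  apply: (@interval_induction _ P c d) => //.
    exists 0%N, (fun=> 0), (fun=> 0); split => //; [by case|by case..|].
    by rewrite big_ord0 !subrr mulr0 addr0.
  move=> m /andP[cm md]; have [mU|mU] := pselect (U m).
    have [h /= h0 hU] : nbhs m U by exact: oU.
    exists h => // u v cu um mv vd hu vh [n [us [vs [H1 H2 H3 H4]]]].
    pose us' (i : 'I_n.+1) := if unlift ord0 i is Some j then us j else u.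
    pose vs' (i : 'I_n.+1) := if unlift ord0 i is Some j then vs j else v.
    have D i : `]us i, vs i[ `&` `]u, v[ = set0.
      rewrite -subset0 => t [] /=; rewrite !in_itv/= => /andP[_ tv] /andP[ut _].
      by have := lt_trans ut tv; rewrite ltNge (H1 i).2.
    exists n.+1, us', vs'; split.
    - move=> i; rewrite /us' /vs'; case: unliftP => [j _|_].
        by have [-> Hv] := H1 j; split=> //; rewrite (le_trans Hv)// (le_trans um).
      by rewrite cu (le_trans um).
    - move=> i j; rewrite /us' /vs'; case: unliftP => [i' ->|->];
        case: unliftP => [j' ->|->]; rewrite ?eqxx// => ij.
      + by apply: H2; apply: contra_neq ij => ->.
      + by rewrite setIC.
    - move=> i; rewrite /us' /vs'; case: unliftP => [j _|_]; first exact: H3.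
      move=> t /=; rewrite in_itv/= => /andP[ut tv]; apply: hU => /=.
      by rewrite distrC ltr_distl (lt_trans hu)// (lt_trans tv).
    - rewrite big_ord_recl /us' /vs' unlift_none.
      under eq_bigr do rewrite liftK.
      have := ler_norm (F u - F v); rewrite distrC.
      have : e' * (u - c) <= e' * (v - c).
        by rewrite ler_pM2l// lerD2r (le_trans um).
      lra.
  have cmd : c < m < d.
    rewrite !lt_neqAle cm md !andbT; apply/andP; split.
      by apply/eqP => cE; apply/mU/NU; right; left.
    by apply/eqP => dE; apply/mU/NU; right; right.
  have [dm Fm] : derivable F m 1 /\ 0 <= derive1 F m.
    by apply: contrapT => H; apply/mU/NU; left; apply: NA => /(_ cmd).
  have [h h0 hs] := derive_ge0_straddle dm Fm e'0.
  exists h => // u v cu um mv vd hu vh [n [us [vs [H1 H2 H3 H4]]]].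
  exists n, us, vs; split=> // [i|].
    by have [-> Hv] := H1 i; split=> //; rewrite (le_trans Hv)// (le_trans um).
  have := hs u v hu um mv vh.
  by lra.
move=> [n [us [vs [H1 H2 H3 H4]]]].
have := Hdelta n us vs H1 H2.
have mI i : measurable (`]us i, vs i[%classic : set R) by exact: measurable_itv.
have tI : trivIset [set: 'I_n] (fun i => `]us i, vs i[%classic).
  by apply/trivIsetP => i j _ _ ij; apply: H2.
have -> : \sum_(i < n) (vs i - us i) < delta.
  rewrite -lte_fin (le_lt_trans _ Udelta)// -sumEFin.
  rewrite (eq_bigr (fun i => lebesgue_measure (`]us i, vs i[%classic : set R))).
    rewrite -measure_bigsetU_ord// le_measure ?inE//=.
    - by apply: bigsetU_measurable => i _; exact: mI.
    - exact: open_measurable.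
    - by elim/big_ind : _ => // X Y XU YU; rewrite subUset.
  move=> i _; rewrite lebesgue_measure_itv/= lte_fin EFinB.
  have [/andP[_ uv] _] := H1 i.
  by case: ltgtP uv => // -> _; rewrite -EFinB subrr.
move=> /(_ isT) Hs.
have : e' * (d - c) <= e / 2.
  rewrite /e' invfM mulrA -mulrA ler_piMr// ?divr_ge0// ?ltW//.
  by rewrite mulrC ltr_pdivrMr// mul1r ltrDl.
lra.
Qed.

(** * Absolutely continuous functions and indefinite integrals *)

Section abs_cont_theory.
Variable R : realType.
Implicit Types (c d : R) (F G H k : R -> R).
Local Notation mu := (@lebesgue_measure R).

Lemma abs_contS c d c' d' F :
  c <= c' -> d' <= d -> abs_cont c d F -> abs_cont c' d' F.
Proof.
move=> cc' dd' acF e /acF[delta delta0 Hd]; exists delta => // n u v H.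
apply: Hd => i; have [/andP[? ->] ?] := H i.
by rewrite (le_trans cc')//; split => //; apply: le_trans dd'.
Qed.

Lemma abs_cont_unif c d F : abs_cont c d F -> forall e, 0 < e ->
  exists2 delta, 0 < delta &
    forall s t, c <= s -> s <= t -> t <= d -> t - s < delta -> `|F t - F s| < e.
Proof.
move=> acF e /acF[delta delta0 Hd]; exists delta => // s t cs st td tsd.
have := Hd 1%N (fun=> s) (fun=> t); rewrite !big_ord1; apply => //.
- by move=> _; rewrite cs st.
- by move=> i j; rewrite !ord1 eqxx.
Qed.

Lemma abs_cont_bounded c d F : c <= d -> abs_cont c d F ->
  exists2 B, 0 <= B & forall t, c <= t <= d -> `|F t| <= B.
Proof.
move=> cd acF; have [delta delta0 Hd] := abs_cont_unif acF ltr01.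
pose P s := exists2 B, 0 <= B & forall t, c <= t <= s -> `|F t| <= B.
have : P d.
  apply: (@interval_induction R P c d) => //.
    by exists `|F c| => // t /le_anti <-.
  move=> m _; exists (delta / 2); first by rewrite divr_gt0.
  move=> u v cu um mv vd hu vh [B B0 HB]; exists (B + 1); first exact: addr_ge0.
  move=> t /andP[ct tv]; have [tu|ut] := leP t u.
    by rewrite ler_wpDr//; apply: HB; rewrite ct.
  have /ltW H1 : `|F t - F u| < 1.
    apply: Hd => //; [exact: ltW|exact: le_trans vd|].
    lra.
  rewrite -(subrK (F u) (F t)) (le_trans (ler_normD _ _))// addrC lerD//.
  by apply: HB; rewrite cu lexx.
by [].
Qed.

(** The common source of the closure properties below. *)
Lemma abs_cont_dominated c d F G H (A B : R) :
  0 <= A -> 0 <= B ->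
  (forall s t, c <= s -> s <= t -> t <= d ->
     `|H t - H s| <= A * `|F t - F s| + B * `|G t - G s|) ->
  abs_cont c d F -> abs_cont c d G -> abs_cont c d H.
Proof.
move=> A0 B0 dom acF acG e e0.
have A1 : 0 < A + 1 by rewrite ltr_wpDl.
have B1 : 0 < B + 1 by rewrite ltr_wpDl.
have eA : 0 < e / 2 / (A + 1) by rewrite !divr_gt0.
have eB : 0 < e / 2 / (B + 1) by rewrite !divr_gt0.
have [dF dF0 HF] := acF _ eA; have [dG dG0 HG] := acG _ eB.
exists (Num.min dF dG); first by rewrite lt_min dF0.
move=> n u v uv duv; rewrite lt_min => /andP[sF sG].
have {HF sF} := HF n u v uv duv sF; have {HG sG} := HG n u v uv duv sG.
rewrite !ltr_pdivlMr//.
have : \sum_(i < n) `|H (v i) - H (u i)| <=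
    A * (\sum_(i < n) `|F (v i) - F (u i)|) +
    B * (\sum_(i < n) `|G (v i) - G (u i)|).
  rewrite !mulr_sumr -big_split/=; apply: ler_sum => i _.
  by have [/andP[? ?] ?] := uv i; apply: dom.
have : 0 <= \sum_(i < n) `|F (v i) - F (u i)| by apply: sumr_ge0.
have : 0 <= \sum_(i < n) `|G (v i) - G (u i)| by apply: sumr_ge0.
lra.
Qed.

Lemma abs_contZ c d F (l : R) : abs_cont c d F -> abs_cont c d (fun t => l * F t).
Proof.
move=> acF; apply: (@abs_cont_dominated c d F F _ `|l| 0) => // s t _ _ _.
by rewrite mul0r addr0 -mulrBr normrM.
Qed.

Lemma abs_contD c d F G : abs_cont c d F -> abs_cont c d G ->
  abs_cont c d (fun t => F t + G t).
Proof.
move=> acF acG; apply: (@abs_cont_dominated c d F G _ 1 1) => // s t _ _ _.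
by rewrite !mul1r opprD addrACA ler_normD.
Qed.

Lemma abs_contM c d F G : c <= d -> abs_cont c d F -> abs_cont c d G ->
  abs_cont c d (fun t => F t * G t).
Proof.
move=> cd acF acG; have [A A0 HA] := abs_cont_bounded cd acF.
have [B B0 HB] := abs_cont_bounded cd acG.
apply: (@abs_cont_dominated c d F G _ B A) => // s t cs st td.
have -> : F t * G t - F s * G s = (F t - F s) * G t + F s * (G t - G s) by ring.
rewrite (le_trans (ler_normD _ _))// !normrM mulrC lerD// ler_wpM2r//.
  by apply: HB; rewrite (le_trans cs).
by apply: HA; rewrite cs (le_trans st).
Qed.

(** The primitive is taken from [-oo] after extending [k] by zero, so that it
    is defined on the whole line. *)
Lemma abs_cont_primitive c d k : mu.-integrable `[c, d] (EFin \o k) ->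
  exists2 K, abs_cont c d K &
    {ae mu, forall t, c < t < d -> derivable K t 1 /\ derive1 K t = k t}.
Proof.
move=> ik; pose kr := k \_ `[c, d].
have ikr : mu.-integrable setT (EFin \o kr).
  by rewrite -restrict_EFin; apply/integrable_restrict => //=; rewrite setTI.
have ikrS (D : set R) : measurable D -> mu.-integrable D (EFin \o kr).
  by move=> mD; apply: integrableS ikr.
pose K t := (\int[mu]_(s in `]-oo, t]) kr s)%R.
exists K; last first.
  have := @FTC1Ny R kr (fun y => ikrS _ (measurable_itv _)) (integrable_locally (measurable_itv `[c, d]) ik).
  apply: (@filterS _ _ (ae_filter_ringOfSetsType mu)) => t [dK Kt] /andP[ct td]; split => //; rewrite Kt /kr.
  by rewrite patchE mem_set//= in_itv/= !ltW.
move=> e e0; have [delta [delta0 Hd]] := integral_normr_continuous ikr e0.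
exists delta => // n u v uv duv suv.
have mI i : measurable (`]u i, v i[%classic : set R) by exact: measurable_itv.
have tI : trivIset [set: 'I_n] (fun i => `]u i, v i[%classic).
  by apply/trivIsetP => i j _ _ ij; apply: duv.
have mU : measurable (\big[setU/set0]_(i < n) `]u i, v i[%classic : set R).
  by apply: bigsetU_measurable => i _; exact: mI.
apply: le_lt_trans (Hd _ mU _); last first.
  move: suv; rewrite -lte_fin; apply: le_lt_trans.
  rewrite measure_bigsetU_ord//= -sumEFin; apply: lee_sum => i _.
  rewrite lebesgue_measure_itv/= lte_fin EFinB.
  have [/andP[_ uvi] _] := uv i.
  by case: ltgtP uvi => // -> _; rewrite -EFinB subrr.
have inkr (D : set R) : measurable D -> mu.-integrable D (EFin \o (Num.norm \o kr)).
  by move=> mD; have := integrable_norm (ikrS _ mD).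
rewrite /Rintegral integral_bigsetU_EFin//=; last 3 first.
- exact: index_enum_uniq.
- by apply/trivIsetP => i j _ _; apply: duv.
- by apply: measurable_int; exact: inkr.
rewrite -sum_fine; last first.
  by move=> i _; apply: integrable_fin_num => //; exact: inkr.
apply: ler_sum => i _.
have [/andP[_ uvi] _] := uv i.
rewrite /K Rintegral_itvB ?bnd_simp//; last exact: ikrS.
rewrite -Rintegral_itv_bndo_bndc; last exact: ikrS.
by apply: le_normr_Rintegral => //; exact: ikrS.
Qed.

End abs_cont_theory.

(** * Locally constant functions and a Gronwall estimate *)

Lemma near_dnbhs_unique (R : realType) (T : Type) (phi : R -> T) (m : R) (c c' : T) :
  (\forall p \near m^', phi p = c) -> (\forall p \near m^', phi p = c') -> c = c'.
Proof.
move=> H H'; near m^' => p.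
have <- : phi p = c by near: p.
by near: p.
Unshelve. all: by end_near.
Qed.

(** A function whose germ at each point of an interval is constant, the point
    itself being excluded, is constant.  The values of [phi] at the points
    where it may jump are irrelevant. *)
Lemma locally_constant_itv (R : realType) (T : Type) (O : set R) (phi : R -> T) :
  (forall s t m, O s -> O t -> s <= m <= t -> O m) ->
  (forall m, O m -> exists c, \forall p \near m^', phi p = c) ->
  forall s t c, O s -> O t ->
  (\forall p \near s^', phi p = c) -> \forall p \near t^', phi p = c.
Proof.
move=> Oitv Oloc.
have le_case s t c : s <= t -> O s -> O t ->
    (\forall p \near s^', phi p = c) -> \forall p \near t^', phi p = c.
  move=> st Os Ot Hs.
  apply: (@interval_induction R (fun t => \forall p \near t^', phi p = c) s t) => //.
  move=> m smt; have [c' Hm] := Oloc _ (Oitv s t m Os Ot smt).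
  move: Hm; rewrite near_withinE => -[h /= h0 hm].
  exists h => // u v su um mv vt hu vh Pu.
  have {}hm p : m - h < p -> p < m + h -> p != m -> phi p = c'.
    by move=> hp ph pm; apply: hm => //=; rewrite distrC ltr_distl hp.
  have nearc' w : m - h < w -> w < m + h -> \forall p \near w^', phi p = c'.
    move=> hw wh.
    have Nm : \forall p \near w^', p != m.
      have [wm|mw|->] := ltgtP w m; last exact: nbhs_dnbhs_neq.
        near=> p; rewrite lt_eqF//; near: p.
        by apply: nbhs_dnbhs; exact: lt_nbhsl.
      near=> p; rewrite gt_eqF//; near: p.
      by apply: nbhs_dnbhs; exact: lt_nbhsr.
    near=> p; apply: hm; last by near: p.
    - by near: p; apply: nbhs_dnbhs; exact: lt_nbhsr.
    - by near: p; apply: nbhs_dnbhs; exact: lt_nbhsl.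
  have <- : c' = c.
    by apply: near_dnbhs_unique Pu; apply: nearc' => //; apply: le_lt_trans um _; rewrite ltrDl.
  by apply: nearc' => //; apply: lt_le_trans mv; rewrite ltrBlDr ltrDl.
move=> s t c Os Ot Hs; have [st|ts] := leP s t; first exact: le_case Hs.
have [c' Ht] := Oloc _ Ot.
by rewrite (near_dnbhs_unique Hs (le_case _ _ _ (ltW ts) Ot Os Ht)).
Unshelve. all: by end_near. Qed.

Section growth.
Variable R : realType.
Implicit Types (c d p q m : R) (F K N k : R -> R).
Local Notation mu := (@lebesgue_measure R).

Lemma abs_cont_ae_const c d F : c <= d -> abs_cont c d F ->
  {ae mu, forall t, c < t < d -> derivable F t 1 /\ derive1 F t = 0} ->
  F c = F d.
Proof.
move=> cd acF dF; apply/eqP; rewrite eq_le; apply/andP; split.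
  apply: abs_cont_ae_nondecreasing => //.
  apply: (@filterS _ _ (ae_filter_ringOfSetsType mu)) dF => t H /H[? ->].
  by split.
rewrite -lerN2 -[leLHS]mulN1r -[leRHS]mulN1r.
apply: (@abs_cont_ae_nondecreasing _ c d (fun t => -1 * F t)) => //.
  exact: abs_contZ.
apply: (@filterS _ _ (ae_filter_ringOfSetsType mu)) dF => t H /H[dF F0].
have D : is_derive t 1 (fun t => -1 * F t) (-1 * derive1 F t).
  rewrite derive1E; apply: is_deriveZ; exact/derivableP.
split; first exact: ex_derive.
by rewrite derive1E derive_val F0 mulr0.
Qed.

Lemma abs_cont_at_right c d F : c < d -> abs_cont c d F -> F t @[t --> c^'+] --> F c.
Proof.
move=> cd acF; apply/cvgrPdist_lt => e e0.
have [delta delta0 Hd] := abs_cont_unif acF e0.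
near=> t; rewrite distrC; apply: Hd => //.
- by apply: ltW; near: t; exact: nbhs_right_lt.
- by rewrite ltrBlDl; near: t; apply: nbhs_right_lt; rewrite ltrDl.
Unshelve. all: by end_near. Qed.

Lemma abs_cont_at_left c d F : c < d -> abs_cont c d F -> F t @[t --> d^'-] --> F d.
Proof.
move=> cd acF; apply/cvgrPdist_lt => e e0.
have [delta delta0 Hd] := abs_cont_unif acF e0.
near=> t; apply: Hd => //.
- by apply: ltW; near: t; exact: nbhs_left_gt.
- rewrite ltrBlDr -ltrBlDl; near: t; apply: nbhs_left_gt.
  by rewrite ltrBlDr ltrDl.
Unshelve. all: by end_near. Qed.

(** Gronwall's inequality [|N'| <= k N] on an interval where the primitive of
    [k] varies by at most one half: any bound of [N] can then be halved, so
    [N] vanishes as soon as its infimum is zero. *)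
Lemma gronwall_small p q N k K : abs_cont p q K ->
  {ae mu, forall t, p < t < q -> derivable K t 1 /\ derive1 K t = k t} ->
  (forall t, 0 <= k t) -> (forall t, 0 <= N t) ->
  (forall s t, p < s -> s <= t -> t < q -> abs_cont s t N) ->
  {ae mu, forall t, p < t < q ->
     derivable N t 1 /\ `|derive1 N t| <= k t * N t} ->
  (forall s t, p < s < q -> p < t < q -> K t - K s <= 2^-1) ->
  (exists B, forall t, p < t < q -> N t <= B) ->
  (forall e, 0 < e -> exists2 s, p < s < q & N s < e) ->
  forall t, p < t < q -> N t = 0.
Proof.
move=> acK dK k0 N0 acN dN Ksmall Nbd Ninf.
(* M K + N and M K - N are both nondecreasing when M bounds N *)
have step M : (forall t, p < t < q -> N t <= M) ->
    forall t, p < t < q -> N t <= M / 2.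
  move=> HM.
  have M0 : 0 <= M.
    have [s sJ _] := Ninf 1 ltr01.
    exact: le_trans (N0 s) (HM s sJ).
  have bound (l : R) s t : `|l| = 1 -> p < s < q -> p < t < q -> s <= t ->
      M * K s + l * N s <= M * K t + l * N t.
    move=> l1 /andP[ps sq] /andP[pt tq] st.
    apply: (@abs_cont_ae_nondecreasing _ s t (fun t => M * K t + l * N t)) => //.
      apply: abs_contD; apply: abs_contZ; last exact: acN.
      by apply: abs_contS acK; exact: ltW.
    have := @filterI _ _ (ae_filter_ringOfSetsType mu) _ _ dK dN.
    apply: (@filterS _ _ (ae_filter_ringOfSetsType mu)).
    move=> w /= [H1 H2] /andP[sw wt].
    have pwq : p < w < q by rewrite (lt_trans ps)//= (lt_trans wt).
    have [dKw Kw] := H1 pwq; have [dNw Nw] := H2 pwq.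
    have D : is_derive w 1 (fun t => M * K t + l * N t)
        (M * derive1 K w + l * derive1 N w).
      rewrite !derive1E; apply: is_deriveD; apply: is_deriveZ; exact/derivableP.
    split; first exact: ex_derive.
    rewrite derive1E derive_val Kw.
    have : `|l * derive1 N w| <= k w * M.
      rewrite normrM l1 mul1r (le_trans Nw)// ler_wpM2l//; exact: HM.
    by rewrite ler_norml => /andP[]; lra.
  move=> t tJ; apply/ler_addgt0Pl => e e0; have [s sJ Nse] := Ninf e e0.
  have [st|/ltW ts] := leP s t.
    have := bound (-1) s t ltac:(by rewrite normrN1) sJ tJ st.
    have : M * (K t - K s) <= M * 2^-1 by apply: ler_wpM2l => //; exact: Ksmall.
    lra.
  have := bound 1 t s ltac:(by rewrite normr1) tJ sJ ts.
  have : M * (K s - K t) <= M * 2^-1 by apply: ler_wpM2l => //; exact: Ksmall.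
  lra.
move=> t tJ; pose S := [set N s | s in [set s | p < s < q]].
have [B HB] := Nbd.
have ubS s : p < s < q -> N s <= sup S.
  move=> sJ; apply: ub_le_sup; last by exists s.
  by exists B => _ [w wJ <-]; exact: HB.
have : sup S <= sup S / 2.
  apply: ge_sup; first by exists (N t); exists t.
  by move=> _ [s sJ <-]; exact: step sJ.
have := ubS t tJ; have := N0 t => N0t Nt S0.
by apply/eqP; rewrite eq_le N0t andbT; lra.
Qed.

End growth.

(** * Real and imaginary parts of the interface conditions *)

(** The three factors of an interface matrix applied in turn to a vector. *)
Lemma interface_blocksE (F : comNzRingType) (al rn rn' c s u v : F) :
  (block_mx 1%:M al%:M 0 1%:M : 'M[F]_(1 + 1)) *m
    ((block_mx rn%:M 0 0 rn'%:M : 'M[F]_(1 + 1)) *m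
      ((block_mx c%:M (- s)%:M s%:M c%:M : 'M[F]_(1 + 1)) *m
        (col_mx u%:M v%:M : 'M[F]_(1 + 1, 1)))) =
  col_mx (rn * (c * u - s * v) + al * (rn' * (s * u + c * v)))%:M
         (rn' * (s * u + c * v))%:M.
Proof.
rewrite !(@mul_block_col _ 1 1 1 1 1) -!scalar_mxM !mul0mx !add0r addr0 mulNr.
rewrite !mul1mx.
have scalarD (p q : F) : (p%:M + q%:M : 'M[F]_1) = (p + q)%:M.
  by rewrite -raddfD.
by rewrite !scalarD -!scalar_mxM scalarD.
Qed.

Section complex_interface.
Context (R : realType).
Local Open Scope complex_scope.

Lemma interface_matrixE (al rn tn : R) (um dum up dup : R[i]) :
  cvec2 up dup =
    map_mx (real_complex R) (interface_matrix al rn tn) *m cvec2 um dum <->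
  dup = (rn^-1)%:C * ((sin tn)%:C * um + (cos tn)%:C * dum) /\
  up = rn%:C * ((cos tn)%:C * um - (sin tn)%:C * dum) + al%:C * dup.
Proof.
rewrite /cvec2 /interface_matrix !map_mxM/= !(@map_block_mx _ _ _ 1 1 1 1).
rewrite !map_scalar_mx !map_mx0 -!mulmxA rmorphN rmorph1.
rewrite [X in _ = X <-> _]interface_blocksE.
split=> [H|[-> ->]//]; have [H1 H2] := @eq_col_mx _ 1 1 1 _ _ _ _ H.
have := congr1 (fun M : 'M[R[i]]_1 => M 0 0) H1.
have := congr1 (fun M : 'M[R[i]]_1 => M 0 0) H2.
by rewrite !mxE /= !mulr1n => -> ->.
Qed.

(** The two real-linear coordinates of a complex number, treated uniformly. *)
Definition component (pr : R[i] -> R) :=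
  pr = @complex.Re R \/ pr = @complex.Im R.

Section component_theory.
Context (pr : R[i] -> R) (prP : component pr).

Lemma componentD z w : pr (z + w) = pr z + pr w.
Proof. by case: prP z w => -> [p q] [p' q']. Qed.

Lemma componentN z : pr (- z) = - pr z.
Proof. by case: prP z => -> [p q]. Qed.

Lemma componentZ (k : R) z : pr (k%:C * z) = k * pr z.
Proof. by case: prP z => -> [p q] /=; rewrite mul0r ?subr0 ?addr0. Qed.

Lemma component_cderive f : pr \o cderive f = derive1 (pr \o f).
Proof. by case: prP => ->. Qed.

Lemma component_cderivable f t : cderivable f t -> derivable (pr \o f) t 1.
Proof. by case: prP => -> []. Qed.

Lemma component_le_normc z : `|pr z| <= Normc.normc z.
Proof.
by case: prP => ->; case: z => p q; rewrite /Normc.normc /= -sqrtr_sqr;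
  apply: ler_wsqrtr; rewrite ?lerDl ?lerDr sqr_ge0.
Qed.

Lemma cvg_component (F : set_system R) {FF : Filter F} (f : R -> R[i]) l :
  Normc.normc (f s - l) @[s --> F] --> (0 : R) -> (pr \o f) s @[s --> F] --> pr l.
Proof.
move=> /cvgrPdist_lt H; apply/cvgrPdist_lt => e /H.
apply: filterS => t /=; rewrite sub0r normrN distrC; apply: le_lt_trans.
rewrite -componentN -componentD; apply: le_trans (component_le_normc _) _.
exact: ler_norm.
Qed.

Lemma component_abs_cont c d f :
  absolutely_continuous c d f -> abs_cont c d (pr \o f).
Proof.
move=> H e /H[delta delta0 Hd]; exists delta => // n u v H1 H2 H3.
apply: le_lt_trans (Hd n u v H1 H2 H3); apply: ler_sum => i _ /=.
by rewrite -componentN -componentD; exact: component_le_normc.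
Qed.

End component_theory.
End complex_interface.
Arguments component {R} pr.

(** * Square integrability *)

Section square_integrability.
Context (R : realType).
Local Notation mu := (@lebesgue_measure R).
Implicit Types (S M : set R) (u v w : R -> R).

(** The real-valued analogue of [square_integrable]. *)
Definition real_square_integrable S u :=
  measurable_fun S u /\ (\int[mu]_(t in S) (u t ^+ 2)%:E < +oo)%E.

Lemma measurable_sqr S u : measurable_fun S u ->
  measurable_fun S (fun t => (u t ^+ 2)%:E).
Proof. by move=> mu_; apply/measurable_EFinP; exact: measurable_funX. Qed.

Lemma real_square_integrableS S S' u : measurable S -> measurable S' -> S `<=` S' ->
  real_square_integrable S' u -> real_square_integrable S u.
Proof.
move=> mS mS' SS' [m i]; split; first exact: measurable_funS m.
apply: le_lt_trans i; apply: ge0_subset_integral => //.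
  exact: measurable_sqr.
by move=> t _; rewrite lee_fin sqr_ge0.
Qed.

Lemma real_square_integrable_le S u v w : measurable S -> measurable_fun S w ->
  real_square_integrable S u -> real_square_integrable S v ->
  (exists2 C, 0 <= C & {ae mu, forall t, S t -> w t ^+ 2 <= C * (u t ^+ 2 + v t ^+ 2)}) ->
  real_square_integrable S w.
Proof.
move=> mS mw [m_u iu] [m_v iv] [C C0 le_w]; split => //.
have sq0 (f : R -> R) t : S t -> (0 <= (f t ^+ 2)%:E)%E.
  by move=> _; rewrite lee_fin sqr_ge0.
apply: (@le_lt_trans _ _ (\int[mu]_(t in S) (C%:E * ((u t ^+ 2)%:E + (v t ^+ 2)%:E))%E)%E).
  apply: ae_ge0_le_integral => //.
  - exact: sq0.
  - exact: measurable_sqr.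
  - by move=> t _; rewrite -EFinD lee_fin mulr_ge0// addr_ge0 ?sqr_ge0.
  - apply: emeasurable_funM => //.
    by apply: emeasurable_funD; exact: measurable_sqr.
rewrite ge0_integralZl//; last 2 first.
- by apply: emeasurable_funD; exact: measurable_sqr.
- by move=> t _; rewrite adde_ge0 ?lee_fin ?sqr_ge0.
rewrite ge0_integralD//; try exact: measurable_sqr; try exact: sq0.
rewrite lte_mul_pinfty//; last exact: lte_add_pinfty.
Qed.

(** The linear relation may fail on a countable set [M]. *)
Lemma real_square_integrable_combination S M u v w (A B c : R) :
  measurable S -> countable M -> c != 0 ->
  (forall t, S t -> ~ M t -> c * w t = A * u t + B * v t) ->
  real_square_integrable S u -> real_square_integrable S v ->
  real_square_integrable S w.
Proof.
move=> mS cM c0 wE su sv; have [[mu_ iu] [mv iv]] := (su, sv).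
have mM' M' : M' `<=` M -> measurable M'.
  move=> M'M; apply: countable_measurable; last exact: sub_countable (subset_card_le M'M) cM.
  exact: measurable_set1.
have wE' t : S t -> ~ M t -> w t = A / c * u t + B / c * v t.
  by move=> St Mt; apply: (mulfI c0); rewrite wE//; field.
have mw : measurable_fun S w.
  have -> : S = (S `\` M) `|` (S `&` M) by rewrite setUC setUIDK.
  apply/measurable_funU; [|by apply: mM'|split].
  - by apply: measurableD => //; exact: mM'.
  - apply: (@eq_measurable_fun _ _ _ _ _ (fun t => A / c * u t + B / c * v t)).
      by move=> t; rewrite inE => -[St Mt]; rewrite wE'.
    have mSD : measurable (S `\` M) by apply: measurableD => //; exact: mM'.
    apply: measurable_funD; apply: measurable_funM => //.
      exact: measurable_funS mu_.
    exact: measurable_funS mv.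
  - by move=> mSM Y mY; apply: mM' => t [[]].
apply: real_square_integrable_le mw su sv _ => //.
(* Cauchy-Schwarz, with a factor 2 to spare *)
exists (2 * ((A / c) ^+ 2 + (B / c) ^+ 2)).
  by rewrite mulr_ge0// addr_ge0 ?sqr_ge0.
exists M; split; first exact: mM'.
  exact: countable_lebesgue_measure0.
move=> t /= /not_implyP[St]; apply: contra_notP => Mt; rewrite wE'//.
set p := A / c; set q := B / c.
have := sqr_ge0 (p * v t - q * u t).
have : 0 <= (p ^+ 2 + q ^+ 2) * (u t ^+ 2 + v t ^+ 2).
  by rewrite mulr_ge0// addr_ge0 ?sqr_ge0.
lra.
Qed.

Lemma sqr_normcE (z : R[i]) : Normc.normc z ^+ 2 = complex.Re z ^+ 2 + complex.Im z ^+ 2.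
Proof. by case: z => p q; rewrite sqr_sqrtr// addr_ge0 ?sqr_ge0. Qed.

Lemma square_integrable_component S f pr : measurable S -> component pr ->
  square_integrable S f -> real_square_integrable S (pr \o f).
Proof.
move=> mS prP [mRe mIm i]; have mpr : measurable_fun S (pr \o f) by case: prP => ->.
split => //; apply: le_lt_trans i; apply: ge0_le_integral => //.
- by move=> t _; rewrite lee_fin sqr_ge0.
- exact: measurable_sqr.
- apply: (@eq_measurable_fun _ _ _ _ _
    (fun t => ((complex.Re (f t)) ^+ 2)%:E + ((complex.Im (f t)) ^+ 2)%:E)%E).
    by move=> t _; rewrite -EFinD sqr_normcE.
  by apply: emeasurable_funD; exact: measurable_sqr.
- move=> t _; rewrite lee_fin sqr_normcE /=.
  by case: prP => ->; rewrite ?lerDl ?lerDr sqr_ge0.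
Qed.

Lemma component_square_integrable S f : measurable S ->
  (forall pr, component pr -> real_square_integrable S (pr \o f)) ->
  square_integrable S f.
Proof.
move=> mS H; have [mRe iRe] := H _ (or_introl erefl).
have [mIm iIm] := H _ (or_intror erefl); split => //.
under eq_integral do rewrite sqr_normcE EFinD.
rewrite ge0_integralD//; try exact: measurable_sqr; last 2 first.
- by move=> t _; rewrite lee_fin sqr_ge0.
- by move=> t _; rewrite lee_fin sqr_ge0.
exact: lte_add_pinfty.
Qed.

End square_integrability.

(** * Real solutions and their Wronskians *)

Lemma cvg_near_const (R : realType) (f : R -> R) (F : set_system R)
  {FF : ProperFilter F} (l c : R) :
  f t @[t --> F] --> l -> (\forall t \near F, f t = c) -> l = c.
Proof.
move=> fl fc; rewrite -(cvg_lim _ fl)//; exact: norm_lim_near_cst.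
Qed.

Section real_solutions.
Context (R : realType) (a b : \bar R) (V : R -> R) (I : set int) (x : I -> R).
Context (r theta : I -> R) (E : R).
Hypothesis V_loc : locally_integrable (oab a b) V.
Hypothesis x_discrete : interaction_points a b x.
Hypothesis r_gt0 : forall n, 0 < r n.
Local Notation mu := (@lebesgue_measure R).
Local Notation O := (oab a b).
Local Notation D := (oab a b `\` points x).
Implicit Types (u v : R -> R) (alpha : I -> R) (m t : R) (n : I).

(** The one-sided limits of [u] and [u'] at [m], left limits first. *)
Definition one_sided_values u m (um dum up dup : R) :=
  [/\ u t @[t --> m^'-] --> um, derive1 u t @[t --> m^'-] --> dum,
      u t @[t --> m^'+] --> up & derive1 u t @[t --> m^'+] --> dup].

(** The interface condition in scalar form.  The shear adds [alpha_n] times the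
    derivative [dup] on the right, so [alpha_n] is irrelevant when [dup = 0]. *)
Definition interface_jump (alpha_n r_n theta_n um dum up dup : R) :=
  dup = r_n^-1 * (sin theta_n * um + cos theta_n * dum) /\
  up = r_n * (cos theta_n * um - sin theta_n * dum) + alpha_n * dup.

(** Real solutions of [- u'' + V u = E u] off the interaction points that
    satisfy the interface conditions. *)
Definition real_solution alpha u :=
  [/\ forall t, D t -> derivable u t 1,
      forall c d, c <= d -> `[c, d] `<=` D ->
        abs_cont c d u /\ abs_cont c d (derive1 u),
      {ae mu, forall t, D t ->
        derivable (derive1 u) t 1 /\ derive1 (derive1 u) t = (V t - E) * u t} &
      forall n, exists um dum up dup, one_sided_values u (x n) um dum up dup /\
        interface_jump (alpha n) (r n) (theta n) um dum up dup].

Definition wronskian u v t := u t * derive1 v t - derive1 u t * v t.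

(** A solution has zero Cauchy data at a point exactly when its energy
    vanishes there. *)
Definition energy u t := u t ^+ 2 + derive1 u t ^+ 2.

Lemma oab_itv s t m : O s -> O t -> s <= m <= t -> O m.
Proof.
move=> /andP[as_ _] /andP[_ tb] /andP[sm mt]; apply/andP; split.
  by apply: lt_le_trans as_ _; rewrite lee_fin.
by apply: le_lt_trans tb; rewrite lee_fin.
Qed.

Lemma oab_punctured m : O m -> exists2 h, 0 < h &
  forall t, `|t - m| < h -> O t /\ (t != m -> D t).
Proof.
move=> Om; have [_ oO _] := V_loc; have [_ _ noacc] := x_discrete.
have [h1 /= h10 H1] : nbhs m O by exact: oO.
have [h2 /= h20 H2] : exists2 h, 0 < h & forall t, `|t - m| < h -> t != m -> ~ points x t.
  have /existsNP[U /not_implyP[[h /= h0 hU] noU]] := noacc m Om.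
  exists h => // t th tm xt; apply: noU; exists t; split => //.
  by apply: hU; rewrite /= distrC.
exists (Num.min h1 h2); first by rewrite lt_min h10.
move=> t; rewrite lt_min => /andP[th1 th2].
have Ot : O t by apply: H1; rewrite /= distrC.
by split => // tm; split => //; exact: H2.
Qed.

(** One-sided limits exist at every point of [(a, b)]; off the interaction
    points the two sides agree. *)
Lemma solution_one_sided_values alpha u m : real_solution alpha u -> O m ->
  exists um dum up dup, one_sided_values u m um dum up dup /\
    ((~ points x m /\ up = um /\ dup = dum) \/ exists2 n, x n = m &
      interface_jump (alpha n) (r n) (theta n) um dum up dup).
Proof.
move=> [_ acu _ iu] Om; have [[n _ xn]|Mm] := pselect (points x m).
  have [um [dum [up [dup [Hv Hj]]]]] := iu n.
  by exists um, dum, up, dup; rewrite -xn; split => //; right; exists n.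
have [h h0 hD] := oab_punctured Om.
have hD' t : `|t - m| < h -> D t.
  move=> th; have [Ot Dt] := hD t th.
  by have [->|/Dt//] := eqVneq t m.
exists (u m), (derive1 u m), (u m), (derive1 u m); split; last by left.
have h2 : 0 < h / 2 by rewrite divr_gt0.
have [||ul dul] := acu (m - h / 2) m.
- by rewrite gerBl ltW.
- move=> t /=; rewrite in_itv/= => /andP[mt tm]; apply: hD'.
  rewrite ltr_distl; apply/andP; split; lra.
have [||ur dur] := acu m (m + h / 2).
- by rewrite lerDl ltW.
- move=> t /=; rewrite in_itv/= => /andP[mt tm]; apply: hD'.
  rewrite ltr_distl; apply/andP; split; lra.
split.
- by apply: abs_cont_at_left ul; rewrite ltrBlDr ltrDl.
- by apply: abs_cont_at_left dul; rewrite ltrBlDr ltrDl.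
- by apply: abs_cont_at_right ur; rewrite ltrDl.
- by apply: abs_cont_at_right dur; rewrite ltrDl.
Qed.

Lemma wronskian_segment alpha alpha' u v c d :
  real_solution alpha u -> real_solution alpha' v ->
  c <= d -> `[c, d] `<=` D -> wronskian u v c = wronskian u v d.
Proof.
move=> [Du acu aeu _] [Dv acv aev _] cd cdD.
have [ac1 ac2] := acu _ _ cd cdD; have [ac3 ac4] := acv _ _ cd cdD.
apply: abs_cont_ae_const => //.
  have -> : wronskian u v = fun t => u t * derive1 v t + -1 * (derive1 u t * v t).
    by apply/funext => t; rewrite mulN1r.
  by apply: abs_contD; [exact: abs_contM | apply: abs_contZ; exact: abs_contM].
have := @filterI _ _ (ae_filter_ringOfSetsType mu) _ _ aeu aev.
apply: (@filterS _ _ (ae_filter_ringOfSetsType mu)) => t /= [H1 H2] /andP[ct td].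
have Dt : D t by apply: cdD; rewrite /= in_itv/= !ltW.
have [d1 e1] := H1 Dt; have [d2 e2] := H2 Dt.
have is1 := derivableP (Du t Dt); rewrite -derive1E in is1.
have is2 := derivableP (Dv t Dt); rewrite -derive1E in is2.
have is3 := derivableP d1; rewrite -derive1E e1 in is3.
have is4 := derivableP d2; rewrite -derive1E e2 in is4.
have isW : is_derive t 1 (wronskian u v)
    ((u t *: ((V t - E) * v t) + derive1 v t *: derive1 u t) -
     (derive1 u t *: derive1 v t + v t *: ((V t - E) * u t))).
  by apply: is_deriveB; apply: is_deriveM.
split; first exact: ex_derive.
by rewrite derive1E derive_val /GRing.scale/=; ring.
Qed.

Lemma cvg_wronskian u v (F : set_system R) {FF : Filter F} (u0 u1 v0 v1 : R) :
  u t @[t --> F] --> u0 -> derive1 u t @[t --> F] --> u1 ->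
  v t @[t --> F] --> v0 -> derive1 v t @[t --> F] --> v1 ->
  wronskian u v t @[t --> F] --> u0 * v1 - u1 * v0.
Proof. by move=> *; apply: cvgB; apply: cvgM. Qed.

(** Near an interaction point the constants on the two sides agree because the
    interface matrix has determinant 1. *)
Lemma wronskian_germ alpha alpha' u v m :
  real_solution alpha u -> real_solution alpha' v -> O m ->
  (forall n, x n = m -> alpha n = alpha' n) ->
  exists c, \forall t \near m^', wronskian u v t = c.
Proof.
move=> su sv Om aa'; have [h h0 hD] := oab_punctured Om.
have Wr s t : m < s -> s <= t -> t < m + h -> wronskian u v s = wronskian u v t.
  move=> ms st th; apply: wronskian_segment su sv st _ => w /=.
  rewrite in_itv/= => /andP[sw wt]; apply: (hD w _).2.
    rewrite ltr_distl; apply/andP; split; lra.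
  by rewrite gt_eqF//; exact: lt_le_trans sw.
have Wl s t : m - h < s -> s <= t -> t < m -> wronskian u v s = wronskian u v t.
  move=> ms st th; apply: wronskian_segment su sv st _ => w /=.
  rewrite in_itv/= => /andP[sw wt]; apply: (hD w _).2.
    rewrite ltr_distl; apply/andP; split; lra.
  by rewrite lt_eqF//; exact: le_lt_trans th.
have [um [dum [up [dup [[ul dul ur dur] ju]]]]] := solution_one_sided_values su Om.
have [vm [dvm [vp [dvp [[vl dvl vr dvr] jv]]]]] := solution_one_sided_values sv Om.
have Wlim_r : wronskian u v t @[t --> m^'+] --> up * dvp - dup * vp.
  exact: cvg_wronskian.
have Wlim_l : wronskian u v t @[t --> m^'-] --> um * dvm - dum * vm.
  exact: cvg_wronskian.
pose c := wronskian u v (m + h / 2); pose c' := wronskian u v (m - h / 2).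
have Cr t : m < t -> t < m + h -> wronskian u v t = c.
  move=> mt th; have [st|/ltW ts] := leP (m + h / 2) t.
    by apply/esym/Wr => //; lra.
  by apply: Wr => //; lra.
have Cl t : m - h < t -> t < m -> wronskian u v t = c'.
  move=> mt th; have [st|/ltW ts] := leP (m - h / 2) t.
    by apply/esym/Wl => //; lra.
  by apply: Wl => //; lra.
have Er : up * dvp - dup * vp = c.
  apply: (cvg_near_const Wlim_r); near=> t; apply: Cr.
    by near: t; exact: nbhs_right_gt.
  by near: t; apply: nbhs_right_lt; rewrite ltrDl.
have El : um * dvm - dum * vm = c'.
  apply: (cvg_near_const Wlim_l); near=> t; apply: Cl.
    by near: t; apply: nbhs_left_gt; rewrite ltrBlDr ltrDl.
  by near: t; exact: nbhs_left_lt.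
have cc' : c = c'.
  rewrite -Er -El.
  case: ju => [[nm [-> ->]]|[n xn [dupE upE]]];
    case: jv => [[nm' [-> ->]]|[k xk [dvpE vpE]]] //.
  - by exfalso; apply: nm; exists k.
  - by exfalso; apply: nm'; exists n.
  have kn : k = n by case: x_discrete => inj _ _; apply: inj; rewrite xn.
  rewrite kn -(aa' n xn) in dvpE vpE.
  have rn0 : r n != 0 by rewrite gt_eqF.
  rewrite upE vpE dupE dvpE.
  have := cos2Dsin2 (theta n) => cs.
  transitivity ((cos (theta n) ^+ 2 + sin (theta n) ^+ 2) * (um * dvm - dum * vm)).
    by field.
  by rewrite cs mul1r.
exists c; near=> t.
have tm : t != m by near: t; exact: nbhs_dnbhs_neq.
have th : `|t - m| < h.
  near: t; apply: nbhs_dnbhs; exists h => // t /=; by rewrite distrC.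
move: th; rewrite ltr_distl => /andP[mt th].
have [mt'|tm'|tE] := ltgtP m t; first exact: Cr.
  by rewrite cc'; exact: Cl.
by rewrite tE eqxx in tm.
Unshelve. all: by end_near. Qed.

(** * Uniqueness of solutions *)

(** A neighbourhood of [m] on which the primitive of [|1 + V - E|] varies by at
    most one half, as required by [gronwall_small]. *)
Lemma potential_primitive m : O m -> exists h K, [/\ 0 < h,
  forall t, `|t - m| < h -> O t /\ (t != m -> D t),
  abs_cont (m - h) (m + h) K,
  {ae mu, forall t, m - h < t < m + h ->
     derivable K t 1 /\ derive1 K t = `|1 + V t - E|} &
  forall s t, m - h < s < m + h -> m - h < t < m + h -> K t - K s <= 2^-1].
Proof.
move=> Om; have [h0 h00 hD] := oab_punctured Om.
pose h1 := h0 / 2; have h10 : 0 < h1 by rewrite divr_gt0.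
have SO : `[m - h1, m + h1] `<=` O.
  move=> t /=; rewrite in_itv/= => /andP[mt tm]; apply: (hD t _).1.
  rewrite ltr_distl; apply/andP; split; rewrite /h1 in h10 mt tm; lra.
have cS : compact `[m - h1, m + h1] by exact: segment_compact.
have iV : mu.-integrable `[m - h1, m + h1] (EFin \o V).
  have [mV _ intV] := V_loc; apply/integrableP; split; last exact: intV.
  by apply/measurable_EFinP; apply: measurable_funS mV => //; case: V_loc => _ oO _; exact: open_measurable.
have ic : mu.-integrable `[m - h1, m + h1] (EFin \o cst (1 - E)).
  by apply: continuous_compact_integrable => //; exact/continuous_subspaceT/cst_continuous.
have ik : mu.-integrable `[m - h1, m + h1] (EFin \o (fun t => `|1 + V t - E|)).
  apply: integrable_norm.
  have : mu.-integrable `[m - h1, m + h1] ((EFin \o cst (1 - E)%R) \+ (EFin \o V))%E.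
    exact: integrableD.
  by apply: eq_integrable => //= t _; rewrite -EFinD addrAC.
have [K acK dK] := abs_cont_primitive ik.
have [delta delta0 Kd] := abs_cont_unif acK (e := 2^-1) ltac:(by rewrite invr_gt0).
pose h := Num.min h1 (delta / 2).
have h_gt0 : 0 < h by rewrite lt_min h10 divr_gt0.
have hh1 : h <= h1 by rewrite ge_min lexx.
have hdelta : h <= delta / 2 by rewrite ge_min lexx orbT.
exists h, K; split => //.
- move=> t th; apply: hD; apply: lt_trans th _; apply: le_lt_trans hh1 _.
  by rewrite /h1 ltr_pdivrMr// mulr2n mulrDr mulr1 ltrDl.
- by apply: abs_contS acK; lra.
- apply: (@filterS _ _ (ae_filter_ringOfSetsType mu)) dK => t Ht /andP[mt tm].
  by apply: Ht; apply/andP; split; lra.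
- move=> s t /andP[ms sm] /andP[mt tm]; have [st|/ltW ts] := leP s t.
    apply: le_trans (ler_norm _) _; apply/ltW/Kd => //; lra.
  apply: le_trans (ler_norm _) _; rewrite distrC; apply/ltW/Kd => //; lra.
Qed.

Lemma energy_derive alpha u : real_solution alpha u ->
  {ae mu, forall t, D t -> derivable (energy u) t 1 /\
     `|derive1 (energy u) t| <= `|1 + V t - E| * energy u t}.
Proof.
move=> [Du _ aeu _].
apply: (@filterS _ _ (ae_filter_ringOfSetsType mu)) aeu => t /= H1 Dt.
have [d1 e1] := H1 Dt.
have is1 := derivableP (Du t Dt); rewrite -derive1E in is1.
have is3 := derivableP d1; rewrite -derive1E e1 in is3.
have isN : is_derive t 1 (energy u)
    ((u t *: derive1 u t + u t *: derive1 u t) +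
     (derive1 u t *: ((V t - E) * u t) + derive1 u t *: ((V t - E) * u t))).
  have -> : energy u = (u * u) + (derive1 u * derive1 u).
    by apply/funext => s; rewrite /energy !expr2.
  by apply: is_deriveD; apply: is_deriveM.
split; first exact: ex_derive.
rewrite derive1E derive_val /GRing.scale/=.
have -> : u t * derive1 u t + u t * derive1 u t +
   (derive1 u t * ((V t - E) * u t) + derive1 u t * ((V t - E) * u t)) =
   (1 + V t - E) * (2 * u t * derive1 u t) by ring.
rewrite normrM ler_wpM2l// ler_norml /energy; apply/andP; split.
  rewrite -subr_ge0; have := sqr_ge0 (u t + derive1 u t); lra.
have := sqr_ge0 (u t - derive1 u t); lra.
Qed.

Lemma energy_ge0 u t : 0 <= energy u t.
Proof. by rewrite addr_ge0 ?sqr_ge0. Qed.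

Lemma cvg_energy u (F : set_system R) {FF : Filter F} (u0 u1 : R) :
  u t @[t --> F] --> u0 -> derive1 u t @[t --> F] --> u1 ->
  energy u t @[t --> F] --> u0 ^+ 2 + u1 ^+ 2.
Proof. by move=> *; apply: cvgD; apply: cvgM. Qed.

Lemma energy_segment alpha u c d : real_solution alpha u -> c <= d ->
  `[c, d] `<=` D -> abs_cont c d (energy u).
Proof.
move=> [_ acu _ _] cd cdD; have [ac1 ac2] := acu _ _ cd cdD.
by apply: abs_contD; apply: abs_contM.
Qed.

(** The interval lies on one side of [m], hence contains no interaction
    point. *)
Lemma energy0_interval alpha u m p q h K : real_solution alpha u ->
  (forall t, `|t - m| < h -> O t /\ (t != m -> D t)) ->
  abs_cont (m - h) (m + h) K ->
  {ae mu, forall t, m - h < t < m + h ->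
     derivable K t 1 /\ derive1 K t = `|1 + V t - E|} ->
  (forall s t, m - h < s < m + h -> m - h < t < m + h -> K t - K s <= 2^-1) ->
  m - h <= p -> p <= q -> q <= m + h -> (q <= m \/ m <= p) ->
  (exists B, forall t, p < t < q -> energy u t <= B) ->
  (forall e, 0 < e -> exists2 s, p < s < q & energy u s < e) ->
  forall t, p < t < q -> energy u t = 0.
Proof.
move=> su hD acK dK Ksmall hp pq qh mpq Ebd Einf.
have inD t : p < t -> t < q -> D t.
  move=> pt tq; apply: (hD t _).2.
    rewrite ltr_distl; apply/andP; split; lra.
  by case: mpq => H; [rewrite lt_eqF|rewrite gt_eqF] => //; lra.
apply: (@gronwall_small R p q (energy u) (fun t => `|1 + V t - E|) K) => //.
- exact: abs_contS acK.
- apply: (@filterS _ _ (ae_filter_ringOfSetsType mu)) dK => t Ht /andP[mt tm].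
  by apply: Ht; apply/andP; split; lra.
- by move=> t; exact: energy_ge0.
- move=> s t ps st tq; apply: energy_segment su st _ => w /=.
  by rewrite in_itv/= => /andP[sw wt]; apply: inD; lra.
- apply: (@filterS _ _ (ae_filter_ringOfSetsType mu)) (energy_derive su).
  by move=> t Ht /andP[pt tq]; exact/Ht/inD.
- by move=> s t /andP[? ?] /andP[? ?]; apply: Ksmall; apply/andP; split; lra.
Qed.

Lemma energy0_at_right alpha u m : real_solution alpha u -> O m ->
  energy u t @[t --> m^'+] --> (0 : R) -> \forall t \near m^'+, energy u t = 0.
Proof.
move=> su Om E0; have [h [K [h0 hD acK dK Ks]]] := potential_primitive Om.
have [h' /= h'0 E1] : \forall t \near m^'+, energy u t < 1.
  by apply: cvgr_lt E0 _ _; exact: ltr01.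
pose q := m + Num.min h h'.
have mq : m < q by rewrite ltrDl lt_min h0.
near=> t; apply: (@energy0_interval alpha u m m q h K) => //.
- by rewrite gerBl ltW.
- exact: ltW.
- by rewrite lerD2l ge_min lexx.
- by right.
- exists 1 => s /andP[ms sq]; apply/ltW/E1 => //=.
  rewrite ltr0_norm ?subr_lt0// opprB ltrBlDl (lt_le_trans sq)//.
  by rewrite lerD2l ge_min lexx orbT.
- move=> e e0; have Ee : \forall t \near m^'+, energy u t < e by apply: cvgr_lt E0 _ _.
  near m^'+ => s; exists s; last by near: s.
  apply/andP; split; near: s; [exact: nbhs_right_gt|exact: nbhs_right_lt].
- apply/andP; split; near: t; [exact: nbhs_right_gt|exact: nbhs_right_lt].
Unshelve. all: by end_near. Qed.

Lemma energy0_at_left alpha u m : real_solution alpha u -> O m ->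
  energy u t @[t --> m^'-] --> (0 : R) -> \forall t \near m^'-, energy u t = 0.
Proof.
move=> su Om E0; have [h [K [h0 hD acK dK Ks]]] := potential_primitive Om.
have [h' /= h'0 E1] : \forall t \near m^'-, energy u t < 1.
  by apply: cvgr_lt E0 _ _; exact: ltr01.
pose q := m - Num.min h h'.
have mq : q < m by rewrite ltrBlDr ltrDl lt_min h0.
near=> t; apply: (@energy0_interval alpha u m q m h K) => //.
- by rewrite lerB// ge_min lexx.
- exact: ltW.
- by rewrite lerDl ltW.
- by left.
- exists 1 => s /andP[ms sq]; apply/ltW/E1 => //=.
  rewrite gtr0_norm ?subr_gt0// ltrBlDr -ltrBlDl (le_lt_trans _ ms)//.
  by rewrite lerB// ge_min lexx orbT.
- move=> e e0; have Ee : \forall t \near m^'-, energy u t < e by apply: cvgr_lt E0 _ _.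
  near m^'- => s; exists s; last by near: s.
  apply/andP; split; near: s; [exact: nbhs_left_gt|exact: nbhs_left_lt].
- apply/andP; split; near: t; [exact: nbhs_left_gt|exact: nbhs_left_lt].
Unshelve. all: by end_near. Qed.

Lemma interface_jump_eq0 (al rn tn um dum up dup : R) : 0 < rn ->
  interface_jump al rn tn um dum up dup ->
  (um ^+ 2 + dum ^+ 2 == 0) = (up ^+ 2 + dup ^+ 2 == 0).
Proof.
move=> r0 [dupE upE]; have rn0 : rn != 0 by rewrite gt_eqF.
have cs := cos2Dsin2 tn.
(* the interface relations, inverted *)
have E1 : um = cos tn * ((up - al * dup) / rn) + sin tn * (rn * dup).
  rewrite upE dupE -[LHS]mul1r -cs; field; exact: rn0.
have E2 : dum = - sin tn * ((up - al * dup) / rn) + cos tn * (rn * dup).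
  rewrite upE dupE -[LHS]mul1r -cs; field; exact: rn0.
have sq0 (y z : R) : (y ^+ 2 + z ^+ 2 == 0) = (y == 0) && (z == 0).
  by rewrite paddr_eq0 ?sqr_ge0// !sqrf_eq0.
rewrite !sq0; apply/idP/idP => /andP[/eqP y0 /eqP z0].
  by rewrite upE dupE y0 z0 !(mulr0, subr0, addr0) eqxx.
by rewrite E1 E2 y0 z0 !(mulr0, subr0, addr0, mul0r) eqxx.
Qed.

(** Whether the energy vanishes is locally constant: near each point it is
    decided by the one-sided Cauchy data, which vanish on both sides or on
    neither. *)
Lemma energy_germ alpha u m : real_solution alpha u -> O m ->
  exists c, \forall t \near m^', (energy u t == 0) = c.
Proof.
move=> su Om.
have [um [dum [up [dup [[ul dul ur dur] ju]]]]] := solution_one_sided_values su Om.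
have Nl : energy u t @[t --> m^'-] --> um ^+ 2 + dum ^+ 2 by exact: cvg_energy.
have Nr : energy u t @[t --> m^'+] --> up ^+ 2 + dup ^+ 2 by exact: cvg_energy.
have eq0 : (um ^+ 2 + dum ^+ 2 == 0) = (up ^+ 2 + dup ^+ 2 == 0).
  case: ju => [[_ [-> ->]]//|[n _]]; exact: interface_jump_eq0.
exists (up ^+ 2 + dup ^+ 2 == 0).
have Hr : \forall t \near m^'+, (energy u t == 0) = (up ^+ 2 + dup ^+ 2 == 0).
  have [N0|N0] := eqVneq (up ^+ 2 + dup ^+ 2) 0.
    rewrite N0 in Nr; near=> t; apply/eqP; near: t; exact: energy0_at_right su Om Nr.
  by near=> t; apply/negbTE; near: t; exact: cvgr_neq0 Nr N0.
have Hl : \forall t \near m^'-, (energy u t == 0) = (up ^+ 2 + dup ^+ 2 == 0).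
  rewrite -eq0; have [N0|N0] := eqVneq (um ^+ 2 + dum ^+ 2) 0.
    rewrite N0 in Nl; near=> t; apply/eqP; near: t; exact: energy0_at_left su Om Nl.
  by near=> t; apply/negbTE; near: t; exact: cvgr_neq0 Nl N0.
move: Hr Hl; rewrite !near_withinE => Hr Hl; near=> t => tm.
have [mt|tm'|tE] := ltgtP m t; last by rewrite tE eqxx in tm.
  by move: mt; near: t.
by move: tm'; near: t.
Unshelve. all: by end_near. Qed.

(** * Vanishing of the Wronskian of two eigenfunctions *)

Lemma dnbhs_at_right m (P : R -> Prop) :
  (\forall t \near m^', P t) -> \forall t \near m^'+, P t.
Proof.
by rewrite !near_withinE; apply: filterS => t Pt mt; apply: Pt; rewrite gt_eqF.
Qed.

Lemma D_segment_right t : D t -> exists2 h, 0 < h &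
  forall d, d < t + h -> `[t, d] `<=` D.
Proof.
move=> Dt; have [h h0 hD] := oab_punctured Dt.1; exists h => // d dh w /=.
rewrite in_itv/= => /andP[cw wd]; have [->//|wt] := eqVneq w t.
by apply: (hD w _).2 => //; rewrite ltr_distl; apply/andP; split; lra.
Qed.

Lemma wronskian_constant (S : set R) alpha alpha' u v :
  (forall s t m, S s -> S t -> s <= m <= t -> S m) -> S `<=` O ->
  (forall n, S (x n) -> alpha n = alpha' n) ->
  real_solution alpha u -> real_solution alpha' v ->
  exists c, forall t, S t -> D t -> wronskian u v t = c.
Proof.
move=> Sitv SO aa' su sv.
have germ m : S m -> exists c, \forall t \near m^', wronskian u v t = c.
  move=> Sm; apply: wronskian_germ su sv (SO _ Sm) _ => n xn.
  by apply: aa'; rewrite xn.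
have [[s0 Ss0]|noS] := pselect (exists s, S s); last first.
  by exists 0 => t St; exfalso; apply: noS; exists t.
have [c Hc] := germ _ Ss0; exists c => t St Dt.
have Ht := locally_constant_itv Sitv germ Ss0 St Hc.
have [h h0 hD] := D_segment_right Dt.
near t^'+ => s.
have <- : wronskian u v s = c by near: s; exact: dnbhs_at_right.
apply: wronskian_segment su sv _ _.
  by apply: ltW; near: s; exact: nbhs_right_gt.
by apply: hD; near: s; apply: nbhs_right_lt; rewrite ltrDl.
Unshelve. all: by end_near. Qed.

(** Zero Cauchy data on the right of a single point force a solution to
    vanish. *)
Lemma solution_unique alpha u m : real_solution alpha u -> O m ->
  energy u t @[t --> m^'+] --> (0 : R) -> forall t, D t -> u t = 0.
Proof.
move=> su Om E0 t Dt; have [c Hc] := energy_germ su Om.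
have c1 : c = true.
  near m^'+ => s.
  have <- : (energy u s == 0) = c by near: s; exact: dnbhs_at_right.
  apply/eqP; near: s; exact: energy0_at_right su Om E0.
rewrite c1 in Hc.
have Ht := locally_constant_itv oab_itv (fun _ => energy_germ su) Om Dt.1 Hc.
have [h h0 hD] := D_segment_right Dt.
have th : t < t + h / 2 by rewrite ltrDl divr_gt0.
have acE : abs_cont t (t + h / 2) (energy u).
  by apply: energy_segment su (ltW th) _; apply: hD; lra.
have : energy u t = 0.
  apply: cvg_near_const (abs_cont_at_right th acE) _.
  by apply: dnbhs_at_right; near=> s; apply/eqP; near: s.
by move=> /eqP; rewrite paddr_eq0 ?sqr_ge0// sqrf_eq0 => /andP[/eqP].
Unshelve. all: by end_near. Qed.

Lemma component_solution alpha f pr : component pr -> ac_with_derivative a b x f ->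
  {ae mu, forall t, O t -> tau V f t = (E%:C)%C * f t} ->
  (forall n, interface_condition x alpha r theta f n) ->
  real_solution alpha (pr \o f).
Proof.
move=> prP [df acf acdf aef] tauf intf; split.
- by move=> t Dt; apply: component_cderivable => //; exact: df.
- move=> c d cd cdD; split; first by apply: component_abs_cont => //; exact: acf.
  by rewrite -component_cderive//; apply: component_abs_cont => //; exact: acdf.
- have := @filterI _ _ (ae_filter_ringOfSetsType mu) _ _ aef tauf.
  apply: (@filterS _ _ (ae_filter_ringOfSetsType mu)) => t /= [H1 H2] Dt.
  rewrite -component_cderive//; split.
    by apply: component_cderivable => //; exact: H1.
  rewrite -component_cderive//=; have := congr1 pr (H2 Dt.1).
  rewrite /tau componentD// componentN// !componentZ//; lra.
- move=> n; have [um [dum [up [dup [l1 l2 l3 l4 /interface_matrixE[dupE upE]]]]]] := intf n.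
  exists (pr um), (pr dum), (pr up), (pr dup); split.
    by split; rewrite -?component_cderive//; exact: cvg_component.
  split.
    by rewrite {1}dupE componentZ// componentD// !componentZ.
  by rewrite {1}upE componentD// !componentZ// componentD// componentN// !componentZ.
Qed.

Lemma points_countable : countable (points x).
Proof. apply: sub_countable (card_image_le _ _) _; exact: countableP. Qed.

(** If [W(u, v)] were a nonzero constant [c] on [S], the identity
    [c h = u W(h, v) - v W(h, u)] would express every solution [h] as a linear
    combination of [u] and [v]. *)
Lemma wronskian_limit_point (S : set R) alpha alpha' u v f : measurable S ->
  (forall s t m, S s -> S t -> s <= m <= t -> S m) -> S `<=` O ->
  (forall n, S (x n) -> alpha n = alpha' n) ->
  real_solution alpha u -> real_solution alpha' v ->
  real_square_integrable S u -> real_square_integrable S v ->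
  is_solution a b V x alpha r theta (E%:C)%C f -> ~ square_integrable S f ->
  forall t, S t -> D t -> wronskian u v t = 0.
Proof.
move=> mS Sitv SO aa' su sv iu iv [acf tauf intf] nif t St Dt.
have [c Hc] := wronskian_constant Sitv SO aa' su sv; rewrite Hc//.
apply: contrapT => /eqP c0; apply: nif.
apply: component_square_integrable => // pr prP.
have sf : real_solution alpha (pr \o f).
  apply: component_solution => //.
  apply: (@filterS _ _ (ae_filter_ringOfSetsType mu)) tauf => s H /H /eqP.
  by rewrite subr_eq0 => /eqP.
have [A HA] := wronskian_constant Sitv SO aa' sf sv.
have [B HB] := wronskian_constant Sitv SO (fun _ _ => erefl) sf su.
apply: (real_square_integrable_combination (A := A) (B := - B) mS points_countable c0 _ iu iv).
move=> s Ss Ms; have Ds : D s by split => //; exact: SO.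
by rewrite -(Hc s)// -(HA s)// -(HB s)// /wronskian; ring.
Qed.

(** A separated boundary condition along the filter [F], a one-sided
    neighbourhood of an endpoint. *)
Definition boundary_value (F : set_system R) (psi : R) u := exists u0 u1 : R,
  [/\ u t @[t --> F] --> u0, derive1 u t @[t --> F] --> u1 &
      u0 * cos psi + u1 * sin psi = 0].

Lemma wronskian_boundary (F : set_system R) {FF : ProperFilter F} psi u v c :
  boundary_value F psi u -> boundary_value F psi v ->
  (\forall t \near F, wronskian u v t = c) -> c = 0.
Proof.
move=> [u0 [u1 [cu cdu bu]]] [v0 [v1 [cv cdv bv]]] Hc.
rewrite -(cvg_near_const (cvg_wronskian cu cdu cv cdv) Hc).
rewrite -[LHS]mul1r -(cos2Dsin2 psi).
have -> : (cos psi ^+ 2 + sin psi ^+ 2) * (u0 * v1 - u1 * v0) =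
  (u0 * cos psi + u1 * sin psi) * (v1 * cos psi - v0 * sin psi) -
  (v0 * cos psi + v1 * sin psi) * (u1 * cos psi - u0 * sin psi) by ring.
by rewrite bu bv !mul0r subrr.
Qed.

Lemma open_oab : open O. Proof. by case: V_loc. Qed.

Lemma wronskian_left alpha alpha' psi n u v :
  (exists a0, regular_left_at a b V x a0) \/ limit_point_left a b V x alpha r theta ->
  (forall k, k != n -> alpha k = alpha' k) ->
  real_solution alpha u -> real_solution alpha' v ->
  real_square_integrable O u -> real_square_integrable O v ->
  (forall a0, regular_left_at a b V x a0 -> boundary_value a0^'+ psi u) ->
  (forall a0, regular_left_at a b V x a0 -> boundary_value a0^'+ psi v) ->
  forall t, D t -> t < x n -> wronskian u v t = 0.
Proof.
move=> rl aa' su sv iu iv bu bv t Dt tx.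
pose S := [set t | O t /\ t < x n].
have mS : measurable S by apply: open_measurable; apply: openI; [exact: open_oab|exact: open_lt].
have Sitv s s' m : S s -> S s' -> s <= m <= s' -> S m.
  move=> [Os sx] [Os' s'x] sm; split; first exact: oab_itv Os Os' sm.
  by have /andP[_ ms'] := sm; exact: le_lt_trans s'x.
have SO : S `<=` O by move=> s [].
have SS : forall k, S (x k) -> alpha k = alpha' k.
  by move=> k [_ xkn]; apply: aa'; apply: contraTneq xkn => ->; rewrite ltxx.
case: rl => [[a0 ra]|/(_ (E%:C)%C)[f sf nf]]; last first.
  have nif : ~ square_integrable S f.
    by move=> H; apply: nf; exists (x n) => //; case: x_discrete => _ + _; apply; exists n.
  have iS w : real_square_integrable O w -> real_square_integrable S w.
    by apply: real_square_integrableS => //; exact: open_measurable open_oab.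
  exact: wronskian_limit_point mS Sitv SO SS su sv (iS _ iu) (iS _ iv) sf nif _ (conj Dt.1 tx) Dt.
have [c Hc] := wronskian_constant Sitv SO SS su sv; rewrite (Hc _ (conj Dt.1 tx) Dt).
apply: (wronskian_boundary (bu _ ra) (bv _ ra)).
have [aE _ nacc] := ra.
have [/andP[at_ tb] _] := Dt; rewrite aE lte_fin in at_.
have /existsNP[U /not_implyP[[h /= h0 hU] noU]] := nacc.
near=> s.
have as_ : a0 < s by near: s; exact: nbhs_right_gt.
have st : s < t by near: s; exact: nbhs_right_lt.
have sh : s < a0 + h by near: s; apply: nbhs_right_lt; rewrite ltrDl.
have Os : O s.
  by rewrite /oab/= aE lte_fin as_/=; apply: lt_trans tb; rewrite lte_fin.
apply: Hc; first by split => //; exact: lt_trans tx.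
split => // xs; apply: noU; exists s; split => //.
by apply: hU => /=; rewrite ltr0_norm ?subr_lt0// opprB ltrBlDl.
Unshelve. all: by end_near. Qed.

Lemma wronskian_right alpha alpha' psi n u v :
  (exists b0, regular_right_at a b V x b0) \/ limit_point_right a b V x alpha r theta ->
  (forall k, k != n -> alpha k = alpha' k) ->
  real_solution alpha u -> real_solution alpha' v ->
  real_square_integrable O u -> real_square_integrable O v ->
  (forall b0, regular_right_at a b V x b0 -> boundary_value b0^'- psi u) ->
  (forall b0, regular_right_at a b V x b0 -> boundary_value b0^'- psi v) ->
  forall t, D t -> x n < t -> wronskian u v t = 0.
Proof.
move=> rl aa' su sv iu iv bu bv t Dt xt.
pose S := [set t | O t /\ x n < t].
have mS : measurable S by apply: open_measurable; apply: openI; [exact: open_oab|exact: open_gt].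
have Sitv s s' m : S s -> S s' -> s <= m <= s' -> S m.
  move=> [Os sx] [Os' s'x] sm; split; first exact: oab_itv Os Os' sm.
  by have /andP[ms _] := sm; exact: lt_le_trans ms.
have SO : S `<=` O by move=> s [].
have SS : forall k, S (x k) -> alpha k = alpha' k.
  by move=> k [_ xkn]; apply: aa'; apply: contraTneq xkn => ->; rewrite ltxx.
case: rl => [[b0 rb]|/(_ (E%:C)%C)[f sf nf]]; last first.
  have nif : ~ square_integrable S f.
    by move=> H; apply: nf; exists (x n) => //; case: x_discrete => _ + _; apply; exists n.
  have iS w : real_square_integrable O w -> real_square_integrable S w.
    by apply: real_square_integrableS => //; exact: open_measurable open_oab.
  exact: wronskian_limit_point mS Sitv SO SS su sv (iS _ iu) (iS _ iv) sf nif _ (conj Dt.1 xt) Dt.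
have [c Hc] := wronskian_constant Sitv SO SS su sv; rewrite (Hc _ (conj Dt.1 xt) Dt).
apply: (wronskian_boundary (bu _ rb) (bv _ rb)).
have [bE _ nacc] := rb.
have [/andP[at_ tb] _] := Dt; rewrite bE lte_fin in tb.
have /existsNP[U /not_implyP[[h /= h0 hU] noU]] := nacc.
near=> s.
have sb : s < b0 by near: s; exact: nbhs_left_lt.
have ts : t < s by near: s; exact: nbhs_left_gt.
have sh : b0 - h < s by near: s; apply: nbhs_left_gt; rewrite ltrBlDr ltrDl.
have Os : O s.
  by rewrite /oab/= bE lte_fin sb andbT; apply: lt_trans at_ _; rewrite lte_fin.
apply: Hc; first by split => //; exact: lt_trans ts.
split => // xs; apply: noU; exists s; split => //.
by apply: hU => /=; rewrite gtr0_norm ?subr_gt0// ltrBlDr -ltrBlDl.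
Unshelve. all: by end_near. Qed.

(** The conditions inherited by the components of an eigenfunction; the zero
    function is not excluded. *)
Definition real_eigenfunction psia psib alpha u :=
  [/\ real_solution alpha u, real_square_integrable O u,
      forall a0, regular_left_at a b V x a0 -> boundary_value a0^'+ psia u &
      forall b0, regular_right_at a b V x b0 -> boundary_value b0^'- psib u].

Lemma component_eigenfunction psia psib alpha f pr : component pr ->
  H_domain a b V x psia psib alpha r theta f ->
  {ae mu, forall t, O t -> tau V f t = (E%:C)%C * f t} ->
  real_eigenfunction psia psib alpha (pr \o f).
Proof.
move=> prP [iF acf _ intf [bl br]] tauf; split.
- exact: component_solution.
- by apply: square_integrable_component => //; exact: open_measurable open_oab.
- move=> a0 /bl[y0 [y1 [l0 l1 e0]]]; exists (pr y0), (pr y1).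
  rewrite -component_cderive//; split; try exact: cvg_component.
  have := congr1 pr e0; rewrite componentD// mulrC componentZ// mulrC.
  by rewrite [y1 * _]mulrC componentZ// [_ * pr y1]mulrC => ->; case: prP => ->.
- move=> b0 /br[y0 [y1 [l0 l1 e0]]]; exists (pr y0), (pr y1).
  rewrite -component_cderive//; split; try exact: cvg_component.
  have := congr1 pr e0; rewrite componentD// mulrC componentZ// mulrC.
  by rewrite [y1 * _]mulrC componentZ// [_ * pr y1]mulrC => ->; case: prP => ->.
Qed.

(** With [w1], [w1'] the values on the right of [x n] when the parameter there is
    zero, the vanishing of the Wronskian on the left of [x n] reads
    [w1 v' - u' w1' = 0], and on the right [(w1 + alpha n u') v' -
    u' (w1' + alpha' n v') = 0].  If [u'] is nonzero at [x n +], then so [v'] and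
    [w1'] are zero, contradicting uniqueness for [v]. *)
Lemma derivative_vanishes psia psib alpha alpha' n u v :
  regular_or_limit_point a b V x alpha r theta ->
  (forall k, k != n -> alpha k = alpha' k) -> alpha n <> alpha' n ->
  real_eigenfunction psia psib alpha u -> real_eigenfunction psia psib alpha' v ->
  (exists2 t, D t & v t != 0) ->
  derive1 u t @[t --> (x n)^'+] --> (0 : R).
Proof.
move=> [rl rr] aa' an [su iu bul bur] [sv iv bvl bvr] [t0 Dt0 vt0].
have Oxn : O (x n) by case: x_discrete => _ + _; apply; exists n.
have [h h0 hD] := oab_punctured Oxn.
have [_ _ _ /(_ n)[um [dum [up [dup [[ul dul ur dur] [dupE upE]]]]]]] := su.
have [_ _ _ /(_ n)[vm [dvm [vp [dvp [[vl dvl vr dvr] [dvpE vpE]]]]]]] := sv.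
have Wl : um * dvm - dum * vm = 0.
  apply: (cvg_near_const (cvg_wronskian ul dul vl dvl)); near=> t.
  have tx : t < x n by near: t; exact: nbhs_left_lt.
  apply: (wronskian_left rl aa' su sv iu iv bul bvl) tx.
  apply: (hD t _).2; last by rewrite lt_eqF.
  rewrite ltr0_norm ?subr_lt0// opprB ltrBlDr -ltrBlDl.
  by near: t; apply: nbhs_left_gt; rewrite ltrBlDr ltrDl.
have Wr : up * dvp - dup * vp = 0.
  apply: (cvg_near_const (cvg_wronskian ur dur vr dvr)); near=> t.
  have tx : x n < t by near: t; exact: nbhs_right_gt.
  apply: (wronskian_right rr aa' su sv iu iv bur bvr) tx.
  apply: (hD t _).2; last by rewrite gt_eqF.
  rewrite gtr0_norm ?subr_gt0// ltrBlDl.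
  by near: t; apply: nbhs_right_lt; rewrite ltrDl.
suff dup0 : dup = 0 by rewrite dup0 in dur.
apply: contrapT => /eqP dup0.
have rn0 : r n != 0 by rewrite gt_eqF.
have cs := cos2Dsin2 (theta n).
set w1 := r n * (cos (theta n) * um - sin (theta n) * dum) in upE.
set w1' := r n * (cos (theta n) * vm - sin (theta n) * dvm) in vpE.
(* determinant 1 transports the left Wronskian to the unsheared right data *)
have W0 : w1 * dvp - dup * w1' = 0.
  rewrite -[RHS](mulr0 (cos (theta n) ^+ 2 + sin (theta n) ^+ 2)) -[in RHS]Wl.
  by rewrite dupE dvpE /w1 /w1'; field.
have : (alpha n - alpha' n) * (dup * dvp) = 0.
  rewrite -[RHS]subr0 -{1}Wr -W0 upE vpE; ring.
have an0 : alpha n - alpha' n != 0 by rewrite subr_eq0; apply/eqP.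
move=> /eqP; rewrite !mulf_eq0 (negbTE an0) (negbTE dup0) /= => /eqP dvp0.
have w1'0 : w1' = 0.
  move/eqP: W0; rewrite dvp0 mulr0 sub0r oppr_eq0 mulf_eq0 (negbTE dup0) /=.
  by move/eqP.
have vp0 : vp = 0 by rewrite vpE w1'0 dvp0 mulr0 addr0.
have Ev : energy v t @[t --> (x n)^'+] --> vp ^+ 2 + dvp ^+ 2 by exact: cvg_energy.
rewrite vp0 dvp0 expr0n /= addr0 in Ev.
by move: vt0; rewrite (solution_unique sv Oxn Ev Dt0) eqxx.
Unshelve. all: by end_near. Qed.

Lemma component_nonzero f : ~ {ae mu, forall t, O t -> f t = 0 :> R[i]} ->
  exists2 pr, component pr & exists2 t, D t & pr (f t) != 0.
Proof.
move=> nf; apply: contrapT => H; apply: nf; exists (points x); split.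
- apply: countable_measurable points_countable; exact: measurable_set1.
- exact/countable_lebesgue_measure0/points_countable.
move=> t /= /not_implyP[Ot ft]; apply: contrapT => xt; apply: ft.
have H' pr : component pr -> pr (f t) = 0.
  move=> prP; apply/eqP; apply: contra_notT H => prt; exists pr => //.
  by exists t.
have := H' _ (or_introl erefl); have := H' _ (or_intror erefl).
by case: (f t) => p q /= -> ->.
Qed.

Lemma eigenvalue_of_all_parameters psia psib alpha :
  (forall alpha, regular_or_limit_point a b V x alpha r theta) ->
  eigenvalue_set a b V x psia psib r theta E alpha ->
  (forall n, exists alpha', [/\ eigenvalue_set a b V x psia psib r theta E alpha',
     alpha n <> alpha' n & forall k, k != n -> alpha k = alpha' k]) ->
  forall beta, eigenvalue_set a b V x psia psib r theta E beta.
Proof.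
move=> rl [f [Hf nf tauf]] Hn beta; exists f; split => //.
have [iF acf itau intf bc] := Hf; split => // n.
have [um [dum [up [dup [l1 l2 l3 l4 /interface_matrixE[dupE upE]]]]]] := intf n.
exists um, dum, up, dup; split => //; apply/interface_matrixE; split => //.
suff dup0 : dup = 0 by rewrite upE dup0 !mulr0.
have [alpha' [[g [Hg ng taug]] an aa']] := Hn n.
have [pr' prP' nz] := component_nonzero ng.
have dup_pr pr : component pr -> pr dup = 0.
  move=> prP.
  have := derivative_vanishes (rl alpha) aa' an (component_eigenfunction prP Hf tauf)
     (component_eigenfunction prP' Hg taug) nz.
  rewrite -component_cderive// => cv0.
  have cv1 : (pr \o cderive f) t @[t --> (x n)^'+] --> pr dup by exact: cvg_component.
  by rewrite -(cvg_lim _ cv0)// -(cvg_lim _ cv1).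
have := dup_pr _ (or_introl erefl); have := dup_pr _ (or_intror erefl).
by case: (dup) => p q /= -> ->.
Qed.

End real_solutions.

(** * Resampling one coordinate of the product space *)

Section resampling.
Context (R : realType) (I : set int) (p : I -> probability R R).
Context (P1 : probability (Omega1 R I) R).
Hypothesis P1_prod : is_product_measure p P1.
Implicit Types (n : I) (L : Omega1 R I).

Lemma setI_closed_cylinders : setI_closed (@cylinders R I).
Proof.
move=> _ _ [J [U [mU ->]]] [J' [U' [mU' ->]]].
exists (J ++ J'), (fun n => (if n \in J then U n else setT) `&`
                            (if n \in J' then U' n else setT)); split.
  by move=> n; apply: measurableI; case: ifP.
apply/seteqP; split=> [L [H H'] n _|L H].
  by split; case: ifP => // nJ; [exact: H|exact: H'].
split=> n nJ; have := H n; rewrite mem_cat nJ ?orbT => /(_ isT)[] //.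
Qed.

Lemma measurable_cylinder (J : seq I) (U : I -> set R) :
  (forall n, measurable (U n)) -> measurable (cylinder J U : set (Omega1 R I)).
Proof. by move=> mU; apply: sub_sigma_algebra; exists J, U. Qed.

(** Replace the coordinate [n] of the first component by the second
    component. *)
Definition resample n (Lt : Omega1 R I * R) : Omega1 R I :=
  fun k => if k == n then Lt.2 else Lt.1 k.

Lemma preimage_resample_cylinder n (J : seq I) (U : I -> set R) :
  resample n @^-1` cylinder J U =
  cylinder ([seq k <- J | k != n]) U `*` (if n \in J then U n else setT).
Proof.
apply/seteqP; split=> [[L t] H|[L t] [HL Ht] k kJ] /=.
  split=> [k|/=].
    rewrite mem_filter /= => /andP[kn kJ]; have := H k kJ.
    by rewrite /resample (negbTE kn).
  by case: ifP => // nJ; have := H n nJ; rewrite /resample eqxx.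
rewrite /resample /=; have [kn|kn] := eqVneq k n.
  by move: Ht; rewrite /= -kn kJ.
by apply: HL; rewrite mem_filter /= kn.
Qed.

Lemma measurable_resample n : measurable_fun setT (resample n).
Proof.
have := @measurability _ _ _ _ setT (resample n) (@cylinders R I) erefl.
apply.
move=> _ [_ [J [U [mU ->]]] <-]; rewrite setTI preimage_resample_cylinder.
by apply: measurableX; [exact: measurable_cylinder|case: ifP].
Qed.

(** Both measures agree on cylinders, which are stable under intersection and
    generate the sigma-algebra. *)
Lemma resample_invariant n (A : set (Omega1 R I)) : measurable A ->
  P1 A = (P1 \x p n)%E (resample n @^-1` A).
Proof.
move=> mA.
have m0 (k : nat) : (@cylinders R I) ((fun=> setT) k : set (Omega1 R I)).
  by exists [::], (fun=> setT); split => //; apply/seteqP; split=> // L _ ?.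
pose m' := measure_function_pushforward__canonical__measure_function_Measure
    (P1 \x p n)%E (measurable_resample n).
have uniq := @measure_unique _ R (Omega1 R I) (@cylinders R I) (fun=> setT) erefl
  setI_closed_cylinders m0.
have := uniq _ P1 m'. apply => //.
- by rewrite bigcup_const.
- move=> _ [J [U [mU ->]]].
  rewrite /= /pushforward preimage_resample_cylinder.
  rewrite product_measure1E; [|exact: measurable_cylinder|by case: ifP].
  have cylU (K : seq I) : cylinder K U = cylinder (undup K) U.
    by apply/seteqP; split=> L H k; have := H k; rewrite mem_undup.
  rewrite [in LHS]cylU [in RHS]cylU.
  rewrite -filter_undup (P1_prod (undup_uniq J) mU).
  rewrite [X in _ = (X * _)%E](P1_prod (filter_uniq _ (undup_uniq J)) mU) big_filter.
  have [nJ|nJ] := boolP (n \in J).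
    by rewrite (bigD1_seq n) ?mem_undup ?undup_uniq//= muleC.
  rewrite /= probability_setT mule1 [RHS]big_seq_cond [LHS]big_seq_cond.
  apply: eq_bigl => k; rewrite mem_undup; case: (k \in J) / boolP => //= kJ.
  by apply/esym; apply: contraNneq nJ => <-.
- move=> k; apply: le_lt_trans (probability_le1 P1 (@measurableT _ _)) _.
  exact: ltry.
Qed.

Lemma resample_null n (A : set (Omega1 R I)) : measurable A ->
  (forall L, p n [set t | A (resample n (L, t))] = 0%E) -> P1 A = 0%E.
Proof.
move=> mA A0; rewrite (resample_invariant n mA) /product_measure1.
apply: integral0_eq => L _ /=; rewrite -[RHS](A0 L); congr (p n _).
by apply/seteqP; split=> t; rewrite /xsection /= ?inE.
Qed.

(** The points of [X] whose section of [X] in the direction [n] is a null set of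
    [p n]. *)
Definition rigid n (X : set (Omega1 R I)) : set (Omega1 R I) :=
  [set L | X L /\ p n [set t | X (resample n (L, t))] = 0%E].

Lemma resample_section n (X : set (Omega1 R I)) L :
  [set t | X (resample n (L, t))] = xsection (resample n @^-1` X) L.
Proof. by apply/seteqP; split=> t; rewrite /xsection /= ?inE. Qed.

Lemma measurable_rigid n X : measurable X -> measurable (rigid n X).
Proof.
move=> mX.
have -> : rigid n X = X `&` (p n \o xsection (resample n @^-1` X)) @^-1` [set 0%E].
  apply/seteqP; split=> L [XL pL]; split=> //.
    by rewrite /preimage /= -resample_section.
  by rewrite resample_section.
apply: measurableI => //; rewrite -[X in measurable X]setTI.
apply: (measurable_fun_xsection (p n)) => //.
by rewrite -[X in measurable X]setTI; exact: measurable_resample.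
Qed.

(** The section of [rigid n X] through any point is null: it is either empty or
    equal to a null section of [X]. *)
Lemma rigid_null n X : measurable X -> P1 (rigid n X) = 0%E.
Proof.
move=> mX; apply: (resample_null (n := n)); first exact: measurable_rigid.
move=> L.
(* the section in direction n does not depend on the coordinate n *)
have same t : [set t' | X (resample n (resample n (L, t), t'))] =
              [set t' | X (resample n (L, t'))].
  apply/seteqP; split=> t' /=; congr X; apply/funext => k;
  by rewrite /resample /=; case: eqP.
have [p0|p0] := pselect (p n [set t | X (resample n (L, t))] = 0%E).
  rewrite -[RHS]p0; congr (p n _); apply/seteqP; split=> t /=; first by case.
  by move=> Xt; split => //; rewrite same.
rewrite -[RHS](measure0 (p n)); congr (p n _); apply/seteqP; split=> t //=.
by case=> _; rewrite same.
Qed.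

(** A point outside every [rigid n X] can be moved within [X] along each
    coordinate separately, since the measures [p n] have no atoms. *)
Lemma exists_flexible X : (forall n t, p n [set t] = 0%E) -> measurable X ->
  P1 X <> 0%E ->
  exists2 L, X L & forall n, exists L', [/\ X L', L n <> L' n &
    forall k, k != n -> L k = L' k].
Proof.
move=> p_cont mX X0.
(* the countable index set is enumerated by the natural numbers *)
pose N (i : nat) := if unpickle i is Some n then rigid n X else set0.
have : ~ X `<=` \bigcup_i N i.
  move=> XN; apply: X0; apply/negligibleP => //; apply: negligibleS XN _.
  apply: negligible_bigcup => i; rewrite /N; case: unpickle => [n|].
    by apply/negligibleP; [exact: measurable_rigid|exact: rigid_null].
  exact: negligible_set0.
move=> /existsNP[L /not_implyP[XL notN]]; exists L => // n.
have pn0 : p n [set t | X (resample n (L, t))] <> 0%E.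
  by move=> p0; apply: notN; exists (pickle n); [by []|rewrite /N pickleK; split].
have [t Xt tL] : exists2 t, X (resample n (L, t)) & t <> L n.
  apply: contrapT => H; apply: pn0.
  apply/eqP; rewrite eq_le measure_ge0 andbT -(p_cont n (L n)) le_measure ?inE//.
  - rewrite resample_section; apply: measurable_xsection.
    by rewrite -[X in measurable X]setTI; exact: measurable_resample.
  - by move=> t Xt; apply: contrapT => tL; apply: H; exists t.
exists (resample n (L, t)); split => //.
  by rewrite /resample eqxx /= => /esym.
by move=> k kn; rewrite /resample (negbTE kn).
Qed.

End resampling.

(** * The alternative *)

Theorem theorem6p1 (R : realType) (a b : \bar R) (V : R -> R)
    (I : set int) (x : I -> R) (psia psib : R)
    (p : I -> probability R R) (P1 : probability (Omega1 R I) R)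
    (r theta : I -> R) (E : R) (B : set (completed_type P1)) :
  (a < b)%E ->
  locally_integrable (oab a b) V ->
  interaction_points a b x ->
  0 <= psia < pi -> 0 <= psib < pi ->
  is_product_measure p P1 ->
  (forall n t, p n [set t] = 0%E) ->
  (forall n, 0 < r n) ->
  (forall alpha : I -> R, regular_or_limit_point a b V x alpha r theta) ->
  measurable B ->
  B `<=` eigenvalue_set a b V x psia psib r theta E ->
  completed_measure P1 B = 0%E \/
  eigenvalue_set a b V x psia psib r theta E = [set: Omega1 R I].
Proof.
move=> _ Vloc xdisc _ _ Pprod p_cont r0 rlp.
rewrite completed_typeE => -[X mX] [N negN <-] XNE.
have [X0|X0] := pselect (P1 X = 0%E).
  left; have [F [mF F0 NF]] := negN.
  apply/eqP; rewrite eq_le measure_ge0 andbT.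
  have <- : P1 (X `|` F) = 0%E by rewrite measureU0.
  rewrite -(completed_measureE P1 (measurableU _ _ mX mF)).
  by apply: le_outer_measure; exact: setUS.
right; have [L XL flexL] := exists_flexible Pprod p_cont mX X0.
apply/seteqP; split=> // beta _.
apply: (eigenvalue_of_all_parameters Vloc xdisc r0 (alpha := L)) => //.
  by apply: XNE; left.
move=> n; have [L' [XL' LnL' LL']] := flexL n.
by exists L'; split => //; apply: XNE; left.
Qed.
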